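(* (i) For every $k\ge1$ the summand $[2k-2]_{\mathrm{Sp}}\subset\mathfrak h_{1,1}(2k)$ lies in the kernel of the Enomoto–Satoh map. It follows that $ES(\mathfrak u)=0$. (ii) The image $\tilde\sigma_5$ of $\sigma_5$ in $\mathfrak h_{1,1}(10)^{\mathrm{Sp}}$ is characterized (up to scalars) by the condition $ES([\epsilon_4,\tilde\sigma_5])=0$. More precisely, $$\dim\mathrm{Ker}\Big(\mathfrak h_{1,1}(10)^{\mathrm{Sp}}\xrightarrow{[\epsilon_4,\ ]}\mathfrak h_{1,1}(14)\xrightarrow{ES}\mathfrak a_1(12)\Big)=1,$$ whereas $\dim\mathfrak h_{1,1}(10)^{\mathrm{Sp}}=3$.
   Context: For $g\ge1$ let $H_{\mathbb Q}$ be the $2g$-dimensional rational homology of a compact oriented genus $g$ surface with one boundary component, with intersection form $u\cdot v$ and symplectic basis $x_i,y_i$. $\mathcal L_{g,1}=\bigoplus_{k\ge1}\mathcal L_{g,1}(k)$ is the free graded Lie algebra on $H_{\mathbb Q}$, $\mathcal L_{g,1}(k)\subset H_{\mathbb Q}^{\otimes k}$ via $[u,v]=u\otimes v-v\otimes u$. $\mathfrak h_{g,1}(k)=\mathrm{Ker}(H_{\mathbb Q}\otimes\mathcal L_{g,1}(k+1)\xrightarrow{[\,,]}\mathcal L_{g,1}(k+2))\subset H_{\mathbb Q}^{\otimes(k+2)}$ is the space of degree $k$ symplectic derivations of $\mathcal L_{g,1}$, and $\mathfrak h_{g,1}=\bigoplus_{k\ge0}\mathfrak h_{g,1}(k)$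 has the commutator bracket of derivations. The superscript $\mathrm{Sp}$ denotes $\mathrm{Sp}(2g,\mathbb Q)$-invariants. The Enomoto–Satoh map is $ES=ES_k:\mathfrak h_{g,1}(k)\to\mathfrak a_g(k-2):=(H_{\mathbb Q}^{\otimes k})^{\mathbb Z/k}$ for $k\ge2$ ($\mathbb Z/k$ acting by cyclic permutation of tensor factors; $ES=0$ in degrees $0,1$), the composition $\mathfrak h_{g,1}(k)\subset H_{\mathbb Q}^{\otimes(k+2)}\xrightarrow{K_{12}}H_{\mathbb Q}^{\otimes k}\to(H_{\mathbb Q}^{\otimes k})_{\mathbb Z/k}\cong(H_{\mathbb Q}^{\otimes k})^{\mathbb Z/k}$, where $K_{12}(u_1\otimes\cdots\otimes u_{k+2})=(u_1\cdot u_2)u_3\otimes\cdots\otimes u_{k+2}$, then projection to coinvariants, then summation over cyclic permutations. Genus one: $[m]_{\mathrm{Sp}}$ is the irreducible $(m+1)$-dimensional representation of $\mathrm{Sp}(2,\mathbb Q)=\mathrm{SL}(2,\mathbb Q)$. For $k\ge1$, $\mathfrak h_{1,1}(2k)$ contains $[2k-2]_{\mathrm{Sp}}$ with multiplicity one; $\epsilon_{2k}\in[2k-2]_{\mathrm{Sp}}\subset\mathfrak h_{1,1}(2k)$ is its highest weight vector, and $\epsilon_0\in\mathfrak h_{1,1}(0)\cong[2]_{\mathrm{Sp}}$ is the highest weight vector. $\mathfrak u\subset\mathfrak h_{1,1}$ is the Lie subalgebra generated by $\epsilon_{2k}$, $k=0,1,2,\dots$. In the theory of universal mixed elliptic motives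 of Hain and Matsumoto, the action of the absolute Galois group yields a homomorphism $\mathfrak f\to\mathfrak h_{1,1}^{\mathrm{Sp}}$ from the free graded Lie algebra $\mathfrak f$ generated by $\sigma_3,\sigma_5,\dots$; the image $\tilde\sigma_{2k+1}$ of $\sigma_{2k+1}$ lies in $\mathfrak h_{1,1}(4k+2)^{\mathrm{Sp}}$ and normalizes $\mathfrak u$ (i.e. $[\tilde\sigma_{2k+1},\mathfrak u]\subset\mathfrak u$), and $\tilde\sigma_5\neq 0$. *)

(* Defs.v *)
From HB Require Import structures.
From mathcomp Require Import all_boot all_order all_algebra.
From mathcomp Require Import finmap.
From mathcomp.multinomials Require Import monalg.

Set Implicit Arguments.
Unset Strict Implicit.
Unset Printing Implicit Defensive.

Import GRing.Theory Num.Theory.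
Local Open Scope ring_scope.

(* Subspaces, dimensions and generated Lie subalgebras are taken in arbitrary,
   possibly infinite-dimensional, rational vector spaces, and a subspace is
   represented by its membership predicate. *)

Definition is_subspace (V : lmodType rat) (P : V -> Prop) : Prop :=
  P 0 /\ forall (a : rat) (u v : V), P u -> P v -> P (a *: u + v).

Definition has_dim (V : lmodType rat) (P : V -> Prop) (d : nat) : Prop :=
  exists b : 'I_d -> V,
    (forall c : 'I_d -> rat,
        \sum_i c i *: b i = 0 -> forall i, c i = 0) /\
    (forall v : V, P v <-> exists c : 'I_d -> rat, v = \sum_i c i *: b i).

Inductive lie_generated (V : lmodType rat) (br : V -> V -> V)
    (S : V -> Prop) : V -> Prop :=
| lie_gen v : S v -> lie_generated br S v
| lie_zero : lie_generated br S 0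
| lie_lin a u v : lie_generated br S u -> lie_generated br S v ->
    lie_generated br S (a *: u + v)
| lie_br u v : lie_generated br S u -> lie_generated br S v ->
    lie_generated br S (br u v).

(* The tensor algebra of H_Q is the free associative algebra on the symplectic
   basis e_0, ..., e_(2g-1), ordered as x_1, ..., x_g, y_1, ..., y_g; a word of
   length n stands for a basis vector of the n-th tensor power. *)

Definition tensor (g : nat) := {malg rat[{fmonom 'I_(g + g)}]}.

Definition mon (g : nat) (w : seq 'I_(g + g)) : tensor g := << FMonom w >>.

Definition gen (g : nat) (i : 'I_(g + g)) : tensor g := mon [:: i].

Definition linext (g : nat) (F : seq 'I_(g + g) -> tensor g) (t : tensor g) :
    tensor g :=
  \sum_(w <- msupp t) t@_w *: F w.

Definition homog (g n : nat) (t : tensor g) : Prop :=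
  forall w : {fmonom 'I_(g + g)}, w \in msupp t -> size w = n.

(* Matrix of the intersection form: x_i . y_j = delta_ij = - y_j . x_i. *)
Definition omega (g : nat) : 'M[rat]_(g + g) :=
  block_mx 0 1%:M (- 1%:M) 0.

Definition symplectic (g : nat) (A : 'M[rat]_(g + g)) : Prop :=
  A^T *m omega g *m A = omega g.

(* Diagonal action of A on tensors, A acting on H_Q by e_i |-> sum_j A_ji e_j. *)
Definition spact (g : nat) (A : 'M[rat]_(g + g)) : tensor g -> tensor g :=
  linext (fun w => \prod_(i <- w) \sum_j A j i *: gen j).

Definition comm (g : nat) (u v : tensor g) : tensor g := u * v - v * u.

Definition freeLie (g k : nat) (t : tensor g) : Prop :=
  homog k t /\ lie_generated (@comm g) (fun v => exists i, v = gen i) t.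

(* Symplectic derivations of degree k: the elements sum_i e_i (x) f_i of
   H_Q (x) L(k+1) in the kernel of the bracket to L(k+2). *)
Definition sder (g k : nat) (t : tensor g) : Prop :=
  exists f : 'I_(g + g) -> tensor g,
    [/\ forall i, freeLie k.+1 (f i),
        t = \sum_i gen i * f i
      & \sum_i comm (gen i) (f i) = 0].

Definition sder_inv (g k : nat) (t : tensor g) : Prop :=
  sder k t /\ forall A, symplectic A -> spact A t = t.

(* The f_i in the expansion t = sum_i e_i (x) f_i. *)
Definition lcomp (g : nat) (i : 'I_(g + g)) : tensor g -> tensor g :=
  linext (fun w => if w is j :: w' then (if j == i then mon w' else 0) else 0).

(* Poincare duality identifies u (x) v in H_Q (x) L(k+1) with the derivation
   sending a in H_Q to (a . u) v.  Replacing a . u by u . a would only change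
   the sign of the resulting bracket. *)
Definition der_gen (g : nat) (t : tensor g) (i : 'I_(g + g)) : tensor g :=
  \sum_j omega g i j *: lcomp j t.

Fixpoint der_word (g : nat) (t : tensor g) (w : seq 'I_(g + g)) : tensor g :=
  if w is i :: w' then der_gen t i * mon w' + gen i * der_word t w' else 0.

Definition der (g : nat) (t : tensor g) : tensor g -> tensor g :=
  linext (der_word t).

(* A derivation D corresponds to the tensor sum_ij (e_i . e_j) e_j (x) D(e_i);
   the bracket is the tensor of the commutator of the two derivations. *)
Definition der_br (g : nat) (s t : tensor g) : tensor g :=
  \sum_i \sum_j omega g i j *: (gen j * (der s (der t (gen i)) - der t (der s (gen i)))).

Definition K12 (g : nat) : tensor g -> tensor g :=
  linext (fun w => if w is i :: j :: w' then omega g i j *: mon w' else 0).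

(* The projection to the coinvariants of the cyclic group followed by the
   isomorphism onto the invariants given by summation over the group. *)
Definition cyc (g : nat) : tensor g -> tensor g :=
  linext (fun w => \sum_(p < size w) mon (rot p w)).

(* A derivation of degree k is a tensor of length k + 2, so the test on the
   length makes the map vanish in degrees 0 and 1. *)
Definition ES (g : nat) : tensor g -> tensor g :=
  linext (fun w => if (4 <= size w)%N then cyc (K12 (mon w)) else 0).

Definition is_subrep (g : nat) (V : tensor g -> Prop) : Prop :=
  is_subspace V /\
  forall A, symplectic A -> forall t, V t -> V (spact A t).

Definition is_irreducible (g : nat) (V : tensor g -> Prop) : Prop :=
  [/\ is_subrep V,
      exists t, V t /\ t <> 0
    & forall W : tensor g -> Prop, is_subrep W -> (forall t, W t -> V t) ->
        (forall t, W t -> t = 0) \/ (forall t, V t -> W t)].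

(* V is a copy of [m]_Sp. *)
Definition is_irrep (m : nat) (V : tensor 1 -> Prop) : Prop :=
  is_irreducible V /\ has_dim V m.+1.

Definition torus (a : rat) : 'M[rat]_(1 + 1) :=
  block_mx a%:M 0 0 a^-1%:M.

Definition unipotent (a : rat) : 'M[rat]_(1 + 1) :=
  block_mx 1%:M a%:M 0 1%:M.

Definition highest_weight_vector (m : nat) (V : tensor 1 -> Prop)
    (v : tensor 1) : Prop :=
  [/\ V v, v <> 0,
      forall a : rat, a != 0 -> spact (torus a) v = a ^+ m *: v
    & forall a : rat, spact (unipotent a) v = v].

(* V is the summand [2k-2]_Sp of h(2k), for k >= 1. *)
Definition eps_summand (k : nat) (V : tensor 1 -> Prop) : Prop :=
  (forall t, V t -> sder (2 * k)%N t) /\ is_irrep (2 * k - 2)%N V.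

(* v is epsilon_(2k), which is defined up to a nonzero scalar. *)
Definition is_epsilon (k : nat) (v : tensor 1) : Prop :=
  if k == 0%N then highest_weight_vector 2 (@sder 1 0) v
  else exists V, eps_summand k V /\ highest_weight_vector (2 * k - 2)%N V v.

Definition u_alg : tensor 1 -> Prop :=
  lie_generated (@der_br 1) (fun v => exists k, is_epsilon k v).

(* The Galois action which produces the image of sigma_5 is not constructed;
   any element with the known properties of that image is allowed: a nonzero
   Sp-invariant derivation of degree 10 normalizing u. *)
Definition is_sigma5 (s : tensor 1) : Prop :=
  [/\ sder_inv 10 s, s <> 0 & forall v, u_alg v -> u_alg (der_br s v)].

(* Main.v *)
(* The composition of the contraction [K12] with the cyclic sum is, up to sign, the
   divergence of a derivation, read in cyclic words.  It is a 1-cocycle on the Lie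
   algebra of derivations without constant term, so its kernel is closed under the
   bracket.

   A highest weight vector of weight 2k-2 and length 2k+2 involves exactly two
   letters y in each word, so its contraction has a single y.  Cyclic words with a
   single y form a line on which raising is injective, hence the trace of the vector
   is zero; irreducibility extends this to the whole summand, and the cocycle
   property to the algebra generated by these summands.

   For (ii), epsilon_4 and the invariants of degree 10 are fixed by cyclic rotation,
   are killed by raising, and have tails that are Lie elements, hence orthogonal to
   proper shuffles.  These linear relations leave one, respectively three, free
   coordinates, and explicit tensors realise all the solutions.  Since epsilon_4 has
   trace zero, the trace of [epsilon_4, t] is epsilon_4 applied to the trace of t;
   evaluated on the three invariants it has rank two.  An invariant derivation that
   normalizes u has a bracket with epsilon_4 of trace zero, so it lies on the
   remaining line. *)

Require Import Defs.
From Stdlib Require Import ZArith String Ascii.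
From HB Require Import structures.
From mathcomp Require Import all_boot all_order all_algebra.
From mathcomp Require Import finmap.
From mathcomp.multinomials Require Import monalg.
From mathcomp.zify Require Import ssrZ.
From mathcomp Require Import ring.

Import GRing.Theory Num.Theory.
Local Open Scope ring_scope.

Set Implicit Arguments.
Unset Strict Implicit.
Unset Printing Implicit Defensive.

(** The summands and the vectors epsilon are given only through the group action on an
    infinite-dimensional algebra, so the sl_2 theory is recovered from the group. A shear acts on
    tensors of fixed length as a truncated exponential, and its values at powers of two isolate each
    coefficient by a Vandermonde argument. The same argument separates weight spaces; irreducibility
    and the dimension 2k-1 then force a highest weight vector of weight 2k-2.

    In (ii) the two bounds use different descriptions of Lie elements. Upper bounds use shuffle
    relations, which are linear equations in the coordinates; explicit members are certified by the
    Dynkin operator. Rotation invariance cuts the unknowns from the 924 words of length 12 with six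
    letters y to 80 necklaces, few enough for an integer elimination carried out inside the
    proof. *)

(* An interface satisfied by [tensor g]: behind it, unification cannot unfold the
   finitely supported functions that implement the algebra structure. *)
Record free_algebra (n : nat) := FreeAlgebra {
  free_sort :> lalgType rat;
  word : seq 'I_n -> free_sort;
  coord : seq 'I_n -> free_sort -> rat;
  extend : (seq 'I_n -> free_sort) -> free_sort -> free_sort;
  free_scalerAr : forall (a : rat) (s t : free_sort), s * (a *: t) = a *: (s * t);
  word_nil : word [::] = 1;
  word_cat : forall u v, word (u ++ v) = word u * word v;
  coord_word : forall v w, coord w (word v) = (v == w)%:R;
  coord_linear : forall w, linear (coord w : free_sort -> rat^o);
  coord_inj : forall s t, (forall w, coord w s = coord w t) -> s = t;
  word_span : forall t, exists r, t = \sum_(w <- r) coord w t *: word w;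
  extend_linear : forall F, linear (extend F);
  extend_word : forall F w, extend F (word w) = F w
}.

Arguments word {n f}.
Arguments coord {n f}.
Arguments extend {n f}.

(** * The free algebra: words, coordinates and Fox derivatives *)

Definition letter {n} {A : free_algebra n} (i : 'I_n) : A := word [:: i].

(** The left Fox derivative: a tensor is its constant term plus the sum of [letter i * tail i t]. It
    recovers the second factor of H (x) L without a choice of presentation. *)
Definition tail {n} {A : free_algebra n} (i : 'I_n) : A -> A :=
  extend (fun w => if w is j :: w' then (if j == i then word w' else 0) else 0).

Section Words.

Context {n : nat} {A : free_algebra n}.
Implicit Types (s t : A) (u v w : seq 'I_n) (i j : 'I_n).

HB.instance Definition _ w :=
  GRing.isLinear.Build rat A rat^o _ (coord w) (coord_linear w).

HB.instance Definition _ F :=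
  GRing.isLinear.Build rat A A _ (extend F) (extend_linear F).

HB.instance Definition _ i :=
  GRing.isLinear.Build rat A A _ (tail i) (extend_linear _).

Lemma coordD w s t : coord w (s + t) = coord w s + coord w t.
Proof. exact: linearD. Qed.

Lemma coordZ w (a : rat) t : coord w (a *: t) = a * coord w t.
Proof. exact: linearZ. Qed.

Lemma coordP w (a : rat) s t : coord w (a *: s + t) = a * coord w s + coord w t.
Proof. exact: linearP. Qed.

Lemma linear_sum_word (V : lmodType rat) (f : A -> V) (c : seq 'I_n -> rat) r :
  linear f -> f (\sum_(w <- r) c w *: word w) = \sum_(w <- r) c w *: f (word w).
Proof.
move=> lf; elim: r => [|w r IHr]; last by rewrite !big_cons lf IHr.
by rewrite !big_nil -[0 in LHS](addNr 0) -scaleN1r lf scaleN1r addNr.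
Qed.

Lemma supp_ext (V : lmodType rat) (f h : A -> V) (P : pred (seq 'I_n)) t :
  linear f -> linear h -> (forall w, P w -> f (word w) = h (word w)) ->
  (forall w, coord w t != 0 -> P w) -> f t = h t.
Proof.
move=> lf lh fh Pt; have [r ->] := word_span t.
rewrite !(linear_sum_word (coord^~ t)) //; apply: eq_bigr => w _.
by have [->|/Pt/fh->//] := eqVneq (coord w t) 0; rewrite !scale0r.
Qed.

Lemma tensor_ext (V : lmodType rat) (f h : A -> V) :
  linear f -> linear h -> (forall w, f (word w) = h (word w)) -> f =1 h.
Proof. by move=> lf lh fh t; apply: (supp_ext (P := predT)). Qed.

(** Closure rules for the unbundled [linear] predicate. Together with [tensor_ext] they reduce an
    identity between linear maps to its values on words. *)
Lemma mull_lin s : linear (fun t => s * t).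
Proof. by move=> a x y; rewrite mulrDr free_scalerAr. Qed.

Lemma mulr_lin s : linear (fun t => t * s).
Proof. by move=> a x y; rewrite mulrDl -scalerAl. Qed.

Lemma scale_lin (V : lmodType rat) (f : A -> V) (c : rat) :
  linear f -> linear (fun t => c *: f t).
Proof. by move=> lf a x y; rewrite lf scalerDr !scalerA mulrC. Qed.

Lemma add_lin (V : lmodType rat) (f h : A -> V) :
  linear f -> linear h -> linear (fun t => f t + h t).
Proof. by move=> lf lh a x y; rewrite lf lh scalerDr addrACA. Qed.

Lemma sum_lin (V : lmodType rat) (I : Type) (r : seq I) (f : I -> A -> V) :
  (forall k, linear (f k)) -> linear (fun t => \sum_(k <- r) f k t).
Proof.
move=> lf a x y; rewrite scaler_sumr -big_split /=.
by apply: eq_bigr => i _; apply: lf.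
Qed.

Lemma comp_lin (V : lmodType rat) (h : A -> V) (f : A -> A) :
  linear h -> linear f -> linear (fun t => h (f t)).
Proof. by move=> lh lf a x y; rewrite lf lh. Qed.

Lemma id_lin : linear (fun t : A => t).
Proof. by []. Qed.

Lemma zero_lin (V : lmodType rat) : linear (fun t : A => 0 : V).
Proof. by move=> a x y; rewrite scaler0 addr0. Qed.

Lemma word_cons i w : word (i :: w) = letter i * word w :> A.
Proof. exact: (word_cat A [:: i]). Qed.

Lemma word_rcons w i : word (rcons w i) = word w * letter i :> A.
Proof. by rewrite -cats1 word_cat. Qed.

Lemma coord1 w : coord w (1 : A) = (w == [::])%:R.
Proof. by rewrite -word_nil coord_word eq_sym. Qed.

Lemma tail_lin i : linear (tail i : A -> A).
Proof. exact: extend_linear. Qed.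

Lemma tail_nil i : tail i (word [::]) = 0 :> A.
Proof. exact: extend_word. Qed.

Lemma tail_cons i j w : tail i (word (j :: w)) = (j == i)%:R *: word w :> A.
Proof. by rewrite /tail extend_word; case: eqP; rewrite ?scale1r ?scale0r. Qed.

Lemma coord_tail i w t : coord w (tail i t) = coord (i :: w) t.
Proof.
move: t; apply: (@tensor_ext rat^o) => [||v].
- exact: comp_lin (coord_linear w) (tail_lin i).
- exact: coord_linear.
rewrite coord_word; case: v => [|j v]; first by rewrite tail_nil linear0.
by rewrite tail_cons coordZ coord_word eqseq_cons -mulnb natrM.
Qed.

Lemma tail_letter i j t : tail i (letter j * t) = (j == i)%:R *: t.
Proof.
move: t; apply: tensor_ext => [||w]; last by rewrite -word_cons tail_cons.
- exact: comp_lin (tail_lin i) (mull_lin _).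
- exact: scale_lin id_lin.
Qed.

Lemma tail1 i : tail i 1 = 0 :> A.
Proof. by rewrite -word_nil tail_nil. Qed.

Lemma coord_nil_letter i t : coord [::] (letter i * t) = 0.
Proof.
move: t; apply: (@tensor_ext rat^o) => [||w].
- exact: comp_lin (coord_linear _) (mull_lin _).
- exact: zero_lin.
by rewrite -word_cons coord_word.
Qed.

Lemma tensor_eta t : t = (coord [::] t)%:A + \sum_i letter i * tail i t.
Proof.
apply: coord_inj => -[|j w]; rewrite coordD coordZ linear_sum /= coord1.
  by rewrite mulr1 big1 ?addr0 // => i _; rewrite coord_nil_letter.
rewrite mulr0 add0r (bigD1 j) //= big1 => [|i ij]; rewrite -!coord_tail tail_letter.
  by rewrite eqxx scale1r addr0.
by rewrite (negPf ij) scale0r linear0.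
Qed.

Lemma coord_nilM s t : coord [::] (s * t) = coord [::] s * coord [::] t.
Proof.
move: s; apply: (@tensor_ext rat^o) => [||w].
- exact: comp_lin (coord_linear _) (mulr_lin _).
- by move=> a x y; rewrite coordP mulrDl -mulrA.
case: w => [|i w]; first by rewrite word_nil mul1r coord1 mul1r.
by rewrite word_cons -mulrA !coord_nil_letter mul0r.
Qed.

(** The Fox product rule: the right factor is differentiated only behind the constant term of the
    left one. *)
Lemma tailM i s t : tail i (s * t) = tail i s * t + coord [::] s *: tail i t.
Proof.
move: s; apply: tensor_ext => [||w].
- exact: comp_lin (tail_lin _) (mulr_lin _).
- apply: add_lin => [|a x y]; first exact: comp_lin (mulr_lin t) (tail_lin i).
  by rewrite coordP scalerDl scalerA.
case: w => [|j w]; first by rewrite word_nil mul1r tail1 mul0r add0r coord1 scale1r.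
by rewrite word_cons -mulrA !tail_letter coord_nil_letter scale0r addr0 scalerAl.
Qed.

Lemma coord_rcons w i j t :
  coord (rcons w j) (t * letter i) = (i == j)%:R * coord w t.
Proof.
move: t; apply: (@tensor_ext rat^o) => [||v].
- exact: comp_lin (coord_linear _) (mulr_lin _).
- exact: scale_lin (coord_linear w).
by rewrite -word_rcons !coord_word eqseq_rcons mulrC -mulnb natrM.
Qed.

Lemma supp_mul (P Q R : pred (seq 'I_n)) s t :
  (forall u v, P u -> Q v -> R (u ++ v)) ->
  (forall w, coord w s != 0 -> P w) -> (forall w, coord w t != 0 -> Q w) ->
  forall w, coord w (s * t) != 0 -> R w.
Proof.
move=> PQR Ps Qt w; apply: contraNT => nRw; apply/eqP.
apply: (@supp_ext rat^o (fun x => coord w (x * t)) (fun=> 0) P _ _ _ _ Ps) => [||u Pu].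
- exact: comp_lin (coord_linear _) (mulr_lin _).
- exact: zero_lin.
apply: (@supp_ext rat^o (fun x => coord w (word u * x)) (fun=> 0) Q _ _ _ _ Qt) => [||v Qv].
- exact: comp_lin (coord_linear _) (mull_lin _).
- exact: zero_lin.
by rewrite -word_cat coord_word; case: eqP => // uvw; rewrite -uvw PQR in nRw.
Qed.

Lemma supp_extend (P Q : pred (seq 'I_n)) F t :
  (forall u, P u -> forall w, coord w (F u) != 0 -> Q w) ->
  (forall w, coord w t != 0 -> P w) -> forall w, coord w (extend F t) != 0 -> Q w.
Proof.
move=> PQ Pt w; apply: contraNT => nQw; apply/eqP.
apply: (@supp_ext rat^o (fun x => coord w (extend F x)) (fun=> 0) P _ _ _ _ Pt) => [||u Pu].
- exact: comp_lin (coord_linear _) (extend_linear _).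
- exact: zero_lin.
by rewrite extend_word; apply: contraNeq nQw; apply: PQ.
Qed.

End Words.

(** * Derivations, cyclic words and the divergence *)

Fixpoint derive_word {n} {A : free_algebra n} (d : 'I_n -> A) (w : seq 'I_n) : A :=
  if w is i :: w' then d i * word w' + letter i * derive_word d w' else 0.

Definition derive {n} {A : free_algebra n} (d : 'I_n -> A) : A -> A :=
  extend (derive_word d).

Definition derive_head {n} {A : free_algebra n} (d : 'I_n -> A) : A -> A :=
  extend (fun w => if w is i :: w' then d i * word w' else 0).

Definition cyclic {n} {A : free_algebra n} : A -> A :=
  extend (fun w => \sum_(p < size w) word (rot p w)).

Definition contract {n} {A : free_algebra n} (om : 'M[rat]_n) : A -> A :=
  extend (fun w => if w is i :: j :: w' then om i j *: word w' else 0).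

Section Derivations.

Context {n : nat} {A : free_algebra n}.
Implicit Types (s t : A) (u v w : seq 'I_n) (i j : 'I_n) (d e : 'I_n -> A).
Implicit Types (om : 'M[rat]_n).

HB.instance Definition _ d :=
  GRing.isLinear.Build rat A A _ (derive d) (extend_linear _).

HB.instance Definition _ d :=
  GRing.isLinear.Build rat A A _ (derive_head d) (extend_linear _).

HB.instance Definition _ :=
  GRing.isLinear.Build rat A A _ (@cyclic n A) (extend_linear _).

HB.instance Definition _ om :=
  GRing.isLinear.Build rat A A _ (contract om) (extend_linear _).

Lemma derive_lin d : linear (derive d).
Proof. exact: extend_linear. Qed.

Lemma derive_head_lin d : linear (derive_head d).
Proof. exact: extend_linear. Qed.

Lemma cyclic_lin : linear (@cyclic n A).
Proof. exact: extend_linear. Qed.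

Lemma contract_lin om : linear (contract om : A -> A).
Proof. exact: extend_linear. Qed.

Lemma derive1 d : derive d 1 = 0.
Proof. by rewrite -word_nil /derive extend_word. Qed.

Lemma derive_letterM d i t : derive d (letter i * t) = d i * t + letter i * derive d t.
Proof.
move: t; apply: tensor_ext => [||w].
- exact: comp_lin (derive_lin d) (mull_lin _).
- exact: add_lin (mull_lin _) (comp_lin (mull_lin _) (derive_lin d)).
by rewrite -word_cons /derive !extend_word.
Qed.

Lemma derive_letter d i : derive d (letter i) = d i.
Proof. by rewrite -[letter i]mulr1 derive_letterM derive1 mulr1 mulr0 addr0. Qed.

Lemma deriveM d s t : derive d (s * t) = derive d s * t + s * derive d t.
Proof.
move: s; apply: tensor_ext => [||w].
- exact: comp_lin (derive_lin d) (mulr_lin _).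
- exact: add_lin (comp_lin (mulr_lin _) (derive_lin d)) (mulr_lin _).
elim: w => [|i w IHw]; first by rewrite word_nil derive1 mul0r !mul1r add0r.
by rewrite word_cons -mulrA !derive_letterM IHw mulrDl mulrDr !mulrA addrA.
Qed.

Lemma cyclic_word w : cyclic (word w) = \sum_(p < size w) word (rot p w) :> A.
Proof. exact: extend_word. Qed.

Lemma cyclic_word_rot1 w : cyclic (word (rot 1 w)) = cyclic (word w) :> A.
Proof.
case: w => // i w; rewrite !cyclic_word size_rot.
rewrite big_ord_recr [RHS]big_ord_recl /= addrC rot0; congr (_ + _).
  by rewrite -rotD //= addn1 // -[_.+1]/(size (i :: w)) rot_size.
by apply: eq_bigr => p _; rewrite -rotD ?addn1 //= ltnS ltnW.
Qed.

Lemma cyclic_word_cat u v : cyclic (word (u ++ v)) = cyclic (word (v ++ u)) :> A.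
Proof.
elim: u v => [|i u IHu] v; first by rewrite cats0.
by rewrite -cyclic_word_rot1 rot1_cons -cats1 -catA IHu -catA.
Qed.

Lemma cyclicC s t : cyclic (s * t) = cyclic (t * s).
Proof.
move: s; apply: tensor_ext => [||u].
- exact: comp_lin cyclic_lin (mulr_lin _).
- exact: comp_lin cyclic_lin (mull_lin _).
move: t; apply: tensor_ext => [||v].
- exact: comp_lin cyclic_lin (mull_lin _).
- exact: comp_lin cyclic_lin (mulr_lin _).
by rewrite -!word_cat cyclic_word_cat.
Qed.

Lemma cyclic_derive_word d u w :
  cyclic (word u * derive d (word w)) =
  \sum_(p < size w) cyclic (derive_head d (word (drop p w ++ u ++ take p w))).
Proof.
elim: w u => [|i w IHw] u; first by rewrite word_nil derive1 mulr0 linear0 big_ord0.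
rewrite word_cons derive_letterM mulrDr linearD big_ord_recl /= cats0.
congr (_ + _).
  by rewrite mulrA cyclicC mulrA -word_cat cyclicC /derive_head extend_word.
rewrite mulrA -word_rcons IHw; apply: eq_bigr => p _ /=.
by rewrite cat_rcons.
Qed.

(* Up to rotation, a derivation of a word is the sum over its rotations of the
   words in which only the first letter is replaced; in particular derivations
   act on cyclic words. *)
Lemma cyclic_derive d t : cyclic (derive d t) = cyclic (derive_head d (cyclic t)).
Proof.
move: t; apply: tensor_ext => [||w].
- exact: comp_lin cyclic_lin (derive_lin d).
- exact: comp_lin cyclic_lin (comp_lin (derive_head_lin d) cyclic_lin).
rewrite -[derive _ _]mul1r -word_nil cyclic_derive_word cyclic_word !linear_sum.
by apply: eq_bigr.
Qed.

(** Chain rule for Fox derivatives; the vanishing constant terms of [d] remove the second term of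
    [tailM]. The sum over [k] is the Jacobian term that later cancels in cyclic words. *)
Lemma tail_derive d j t : (forall k, coord [::] (d k) = 0) ->
  tail j (derive d t) = \sum_k tail j (d k) * tail k t + derive d (tail j t).
Proof.
move=> d0; move: t; apply: tensor_ext => [||w].
- exact: comp_lin (tail_lin j) (derive_lin d).
- apply: add_lin; last exact: comp_lin (derive_lin d) (tail_lin j).
  by apply: sum_lin => k; apply: comp_lin (mull_lin _) (tail_lin k).
case: w => [|i w].
  rewrite word_nil tail1 derive1 !linear0 big1 ?addr0 // => k _.
  by rewrite tail1 mulr0.
rewrite word_cons derive_letterM linearD /= !tail_letter tailM d0 scale0r addr0 linearZ.
congr (_ + _); rewrite (bigD1 i) //= big1 => [|k ki].
  by rewrite tail_letter eqxx scale1r addr0.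
by rewrite tail_letter eq_sym (negPf ki) scale0r mulr0.
Qed.

Lemma contractE om t : contract om t = \sum_i \sum_j om i j *: tail j (tail i t).
Proof.
move: t; apply: tensor_ext => [||w]; first exact: contract_lin.
  apply: sum_lin => i; apply: sum_lin => j; apply: scale_lin.
  exact: comp_lin (tail_lin j) (tail_lin i).
rewrite /contract extend_word; case: w => [|i [|j w]].
- by rewrite big1 // => i _; rewrite big1 // => j _; rewrite tail_nil !linear0.
- rewrite big1 // => k _; rewrite big1 // => j _.
  by rewrite tail_cons linearZ /= tail_nil !scaler0.
rewrite (bigD1 i) //= (bigD1 j) //= tail_cons eqxx scale1r tail_cons eqxx scale1r.
rewrite !big1 ?addr0 // => [k ki|k kj].
  rewrite big1 // => l _; rewrite tail_cons eq_sym (negPf ki) scale0r linear0.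
  by rewrite scaler0.
by rewrite tail_cons eq_sym (negPf kj) scale0r scaler0.
Qed.

Lemma contract_letters om i j t : contract om (letter i * (letter j * t)) = om i j *: t.
Proof.
move: t; apply: tensor_ext => [||w].
- exact: comp_lin (contract_lin om) (comp_lin (mull_lin _) (mull_lin _)).
- exact: scale_lin id_lin.
by rewrite -!word_cons /contract extend_word.
Qed.

Lemma eq_derive d e : d =1 e -> derive d =1 derive e.
Proof.
move=> de; apply: tensor_ext => [||w]; try exact: derive_lin.
elim: w => [|i w IHw]; first by rewrite word_nil !derive1.
by rewrite word_cons !derive_letterM de IHw.
Qed.

Lemma derive_scale (c : rat) d t : derive (fun i => c *: d i) t = c *: derive d t.
Proof.
move: t; apply: tensor_ext => [||w]; first exact: derive_lin.
  exact: scale_lin (derive_lin d).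
elim: w => [|i w IHw]; first by rewrite word_nil !derive1 scaler0.
by rewrite word_cons !derive_letterM IHw free_scalerAr -scalerAl scalerDr.
Qed.

(** The mixed terms of the two Leibniz rules cancel, so the commutator is again a derivation. The
    sl_2 relations thereby reduce to a check on letters. *)
Lemma derive_commutator (d e : 'I_n -> A) t :
  derive d (derive e t) - derive e (derive d t) =
  derive (fun i => derive d (e i) - derive e (d i)) t.
Proof.
move: t; apply: tensor_ext => [||w].
- apply: add_lin; first exact: comp_lin (derive_lin d) (derive_lin e).
  move=> a s t; rewrite !derive_lin opprD -scalerN.
  by [].
- exact: derive_lin.
have eq_cross (a b c p a' p' : A) :
    a + b + (c + p) - (a' + c + (b + p')) = (a - a') + (p - p').
  rewrite [a' + c + _]addrACA opprD addrACA [a' + b]addrC addrKA.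
  by rewrite [c + p]addrC addrKA.
elim: w => [|i w IHw]; first by rewrite word_nil !derive1 !linear0 addr0.
rewrite word_cons !derive_letterM (linearD (derive d)) (linearD (derive e)) /=.
rewrite !derive_letterM !deriveM -IHw.
by rewrite eq_cross mulrBl mulrBr.
Qed.

(* The divergence of derivations, written with the Fox derivatives [tail], is a
   cocycle with values in cyclic words: the terms with two factors cancel. *)
Lemma cyclic_divergence d e :
  (forall k, coord [::] (d k) = 0) -> (forall k, coord [::] (e k) = 0) ->
  cyclic (\sum_j tail j (derive d (e j) - derive e (d j))) =
  cyclic (derive d (\sum_j tail j (e j))) - cyclic (derive e (\sum_j tail j (d j))).
Proof.
move=> d0 e0.
have -> : \sum_j tail j (derive d (e j) - derive e (d j)) =
    (derive d (\sum_j tail j (e j)) - derive e (\sum_j tail j (d j)))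
    + \sum_j \sum_k (tail j (d k) * tail k (e j) - tail k (e j) * tail j (d k)).
  under eq_bigr => j _ do rewrite linearB /= !tail_derive // opprD addrACA.
  rewrite big_split /= addrC; congr (_ + _); first by rewrite sumrB !linear_sum.
  (* Exchanging the two summation indices in one double sum turns the Jacobian products into
     commutators, which [cyclicC] kills. *)
  rewrite sumrB [X in _ - X]exchange_big -sumrB; apply: eq_bigr => j _ /=.
  by rewrite -sumrB.
rewrite linearD linearB /= [X in _ + X]linear_sum [X in _ + X]big1 ?addr0 // => j _.
by rewrite linear_sum big1 // => k _; rewrite linearB /= cyclicC subrr.
Qed.

End Derivations.

(** * The matrix action and its infinitesimal generators *)

Definition act {n} {A : free_algebra n} (M : 'M[rat]_n) : A -> A :=
  extend (fun w => \prod_(i <- w) \sum_j M j i *: letter j).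

Definition rotate_word {n} {A : free_algebra n} : A -> A :=
  extend (fun w => word (rot 1 w)).

(** With two letters these are the raising and lowering operators of sl_2. *)
Definition replace {n} {A : free_algebra n} (p q : 'I_n) : A -> A :=
  derive (fun i => (i == p)%:R *: letter q).

(** The entry sits in row [q] and column [p] because [act] reads the image of a letter from a
    column. *)
Definition shear (n : nat) (p q : 'I_n) (a : rat) : 'M[rat]_n :=
  1%:M + a *: delta_mx q p.

Section Action.

Context {n : nat} {A : free_algebra n}.
Implicit Types (s t : A) (u v w : seq 'I_n) (i j p q : 'I_n) (M N : 'M[rat]_n).

HB.instance Definition _ M :=
  GRing.isLinear.Build rat A A _ (act M) (extend_linear _).

HB.instance Definition _ :=
  GRing.isLinear.Build rat A A _ (@rotate_word n A) (extend_linear _).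

HB.instance Definition _ p q :=
  GRing.isLinear.Build rat A A _ (replace p q) (extend_linear _).

Lemma act_lin M : linear (act M : A -> A).
Proof. exact: extend_linear. Qed.

Lemma rotate_lin : linear (@rotate_word n A).
Proof. exact: extend_linear. Qed.

Lemma replace_lin p q : linear (replace p q : A -> A).
Proof. exact: extend_linear. Qed.

Lemma iter_lin (f : A -> A) k : linear f -> linear (iter k f).
Proof. by move=> lf a x y; elim: k => //= k ->; apply: lf. Qed.

Lemma act1 M : act M 1 = 1 :> A.
Proof. by rewrite -word_nil /act extend_word big_nil word_nil. Qed.

Lemma act_letterM M i t : act M (letter i * t) = (\sum_j M j i *: letter j) * act M t.
Proof.
move: t; apply: tensor_ext => [||w].
- exact: comp_lin (act_lin M) (mull_lin _).
- exact: comp_lin (mull_lin _) (act_lin M).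
by rewrite -word_cons /act !extend_word big_cons.
Qed.

Lemma act_letter M i : act M (letter i) = \sum_j M j i *: letter j :> A.
Proof. by rewrite -[letter i]mulr1 act_letterM act1 mulr1. Qed.

Lemma actM M s t : act M (s * t) = act M s * act M t.
Proof.
move: s; apply: tensor_ext => [||w].
- exact: comp_lin (act_lin M) (mulr_lin _).
- exact: comp_lin (mulr_lin _) (act_lin M).
elim: w => [|i w IHw]; first by rewrite word_nil act1 !mul1r.
by rewrite word_cons -mulrA !act_letterM IHw mulrA.
Qed.

Lemma act_mulmx M N t : act (M *m N) t = act M (act N t).
Proof.
move: t; apply: tensor_ext => [||w]; first exact: act_lin.
  exact: comp_lin (act_lin _) (act_lin _).
elim: w => [|i w IHw]; first by rewrite word_nil !act1.
rewrite word_cons !act_letterM actM IHw linear_sum; congr (_ * _) => /=.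
under eq_bigr => j _ do rewrite mxE scaler_suml.
rewrite exchange_big; apply: eq_bigr => k _ /=.
rewrite linearZ /= act_letter scaler_sumr; apply: eq_bigr => j _.
by rewrite scalerA mulrC.
Qed.

Lemma act_size M m t : (forall w, coord w t != 0 -> size w == m) ->
  forall w, coord w (act M t) != 0 -> size w == m.
Proof.
apply: supp_extend => u /eqP <- {m t}; elim: u => [|i u IHu] w.
  by rewrite big_nil coord1; case: w => // i w; rewrite eqxx.
rewrite big_cons; case: w => [|j w].
  rewrite coord_nilM linear_sum big1 ?mul0r ?eqxx // => k _ /=.
  by rewrite coordZ coord_word mulr0.
rewrite -coord_tail tailM !linear_sum /=.
rewrite [X in _ + X *: _]big1 => [|k _ /=]; last by rewrite coordZ coord_word mulr0.
rewrite scale0r addr0 (bigD1 j) //= linearZ /= tail_cons eqxx scale1r.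
rewrite big1 => [|k kj]; last first.
  by rewrite linearZ /= tail_cons (negPf kj) scale0r scaler0.
rewrite addr0 word_nil mulr_algl coordZ mulf_eq0 negb_or => /andP[_ /IHu].
by rewrite eqSS.
Qed.

Lemma rotate_letterM i t : rotate_word (letter i * t) = t * letter i.
Proof.
move: t; apply: tensor_ext => [||w].
- exact: comp_lin rotate_lin (mull_lin _).
- exact: mulr_lin.
by rewrite -word_cons /rotate_word extend_word rot1_cons word_rcons.
Qed.

Lemma rotate1 : rotate_word 1 = 1 :> A.
Proof. by rewrite -word_nil /rotate_word extend_word. Qed.

Lemma act_rotate M t : act M (rotate_word t) = rotate_word (act M t).
Proof.
move: t; apply: tensor_ext => [||w].
- exact: comp_lin (act_lin _) rotate_lin.
- exact: comp_lin rotate_lin (act_lin _).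
case: w => [|i w]; first by rewrite word_nil rotate1 act1 rotate1.
rewrite word_cons rotate_letterM act_letterM mulr_suml linear_sum actM act_letter.
rewrite mulr_sumr; apply: eq_bigr => j _ /=.
by rewrite -scalerAl linearZ /= rotate_letterM free_scalerAr.
Qed.

(** On a fixed length the cyclic sum is a sum of powers of one operator, so whatever commutes with a
    single rotation commutes with it. *)
Lemma cyclic_rotate m t : (forall w, coord w t != 0 -> size w == m) ->
  cyclic t = \sum_(k < m) iter k rotate_word t.
Proof.
apply: (supp_ext (h := fun t => \sum_(k < m) iter k rotate_word t)) => [||w /eqP <-].
- exact: cyclic_lin.
- by apply: sum_lin => k; apply: iter_lin rotate_lin.
rewrite cyclic_word; apply: eq_bigr => k _.
have: (k <= size w)%N by apply: ltnW.
elim: (nat_of_ord k) => [|l IHl] lw; first by rewrite rot0.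
by rewrite iterS -IHl ?(ltnW lw) // /rotate_word extend_word -rotD ?add1n.
Qed.

Lemma act_cyclic m M t : (forall w, coord w t != 0 -> size w == m) ->
  act M (cyclic t) = cyclic (act M t).
Proof.
move=> tm; rewrite (cyclic_rotate tm) (cyclic_rotate (act_size tm)) linear_sum.
apply: eq_bigr => k _ /=; elim: (nat_of_ord k) => //= l <-.
by rewrite act_rotate.
Qed.

Lemma act_contract om M t : M^T *m om *m M = om ->
  act M (contract om t) = contract om (act M t).
Proof.
move=> sM; move: t; apply: tensor_ext => [||w].
- exact: comp_lin (act_lin _) (contract_lin _).
- exact: comp_lin (contract_lin _) (act_lin _).
case: w => [|i [|j w]].
- by rewrite word_nil act1 -word_nil /contract !extend_word linear0.
- rewrite act_letter {1}/contract extend_word !linear_sum big1 ?linear0 // => k _.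
  by rewrite linearZ /= {1}/contract extend_word scaler0.
rewrite !word_cons contract_letters !act_letterM linearZ /=.
rewrite mulr_suml linear_sum -[in LHS]sM mxE scaler_suml /=.
under eq_bigr => l _ do rewrite mxE mulr_suml scaler_suml.
rewrite exchange_big; apply: eq_bigr => k _ /=.
rewrite -scalerAl linearZ /= mulr_suml mulr_sumr linear_sum scaler_sumr.
apply: eq_bigr => l _ /=; rewrite mxE -scalerAl free_scalerAr linearZ /=.
by rewrite contract_letters !scalerA mulrAC.
Qed.

Lemma shear_letter p q a i :
  \sum_j shear p q a j i *: letter j = letter i + (a * (i == p)%:R) *: letter q :> A.
Proof.
under eq_bigr => j _ do rewrite !mxE scalerDl.
rewrite big_split /= (bigD1 i) //= eqxx scale1r big1 ?addr0 => [|j ji]; last first.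
  by rewrite (negPf ji) scale0r.
congr (_ + _); rewrite (bigD1 q) //= eqxx /= big1 ?addr0 // => j jq.
by rewrite (negPf jq) mulr0 scale0r.
Qed.

Lemma replace_letterM p q i t :
  replace p q (letter i * t) =
  (i == p)%:R *: (letter q * t) + letter i * replace p q t.
Proof. by rewrite /replace derive_letterM scalerAl. Qed.

(** As [q] differs from [p], the first letter can be replaced only once, at any of the [k] stages;
    this is the factor [k], and it makes [k.-1] harmless at 0. *)
Lemma iter_replace_letterM p q i k t : p != q ->
  iter k (replace p q) (letter i * t) = letter i * iter k (replace p q) t
    + (i == p)%:R *: (k%:R *: (letter q * iter k.-1 (replace p q) t)).
Proof.
move=> pq; elim: k => [|k IHk]; first by rewrite scale0r scaler0 addr0.
rewrite iterS IHk linearD [X in _ + X]linearZ [X in _ + _ *: X]linearZ /=.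
rewrite !replace_letterM [q == p]eq_sym (negPf pq) /= mulr0n scale0r add0r addrAC addrC.
rewrite -scalerDr; congr (_ + _ *: _).
case: k {IHk} => [|k]; first by rewrite scale0r addr0 scale1r.
by rewrite -[k.+2]add1n natrD scalerDl scale1r.
Qed.

(** The shear is the exponential of [a] times [replace p q]; the series stops because each letter is
    replaced at most once. *)
Lemma act_shear m p q a t : p != q -> (forall w, coord w t != 0 -> size w == m) ->
  act (shear p q a) t =
  \sum_(k < m.+1) a ^+ k *: (k`!%:R^-1 *: iter k (replace p q) t).
Proof.
move=> pq.
apply: (supp_ext (h := fun t => \sum_(k < m.+1) _ *: (_ *: iter k _ t))) => [||w].
- exact: act_lin.
- apply: sum_lin => k; apply: scale_lin; apply: scale_lin.
  exact: iter_lin (replace_lin p q).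
(* The truncation is left free above the length: one letter more uses the expansion of the rest at
   two different bounds. *)
move=> /eqP <- {m t}; suff H m : (size w < m)%N ->
    act (shear p q a) (word w) =
    \sum_(k < m) a ^+ k *: (k`!%:R^-1 *: iter k (replace p q) (word w)) :> A.
  exact: H.
elim: w m => [|i w IHw] [//|m] /= wm.
  rewrite word_nil act1 big_ord_recl /= expr0 scale1r fact0 invr1 scale1r.
  rewrite big1 ?addr0 // => k _; rewrite -iterS iterSr.
  rewrite [X in iter _ _ X]derive1 (_ : iter _ _ 0 = 0) ?scaler0 //.
  by elim: (nat_of_ord k) => //= l ->; rewrite linear0.
rewrite word_cons act_letterM shear_letter mulrDl -scalerAl.
under eq_bigr => k _ do rewrite iter_replace_letterM // !scalerDr.
rewrite big_split /= {1}(IHw m.+1) ?(ltnW wm) // mulr_sumr; congr (_ + _).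
  by apply: eq_bigr => k _; rewrite !free_scalerAr.
rewrite big_ord_recl /= scale0r !scaler0 add0r (IHw m) // mulr_sumr scaler_sumr.
apply: eq_bigr => k _; rewrite /bump leq0n add1n /= !free_scalerAr !scalerA.
congr (_ *: _); rewrite exprS factS natrM invfM -!mulrA; congr (_ * _).
rewrite mulrCA; congr (_ * _); rewrite [RHS]mulrC -!mulrA mulfV ?pnatr_eq0 //.
by rewrite mulr1 mulrC.
Qed.

End Action.

(** * Subspaces and dimension in arbitrary rational vector spaces *)

Section Subspaces.

Context {V : lmodType rat}.
Implicit Types (P : V -> Prop) (u v : V).

Lemma subspaceZ P (a : rat) u : is_subspace P -> P u -> P (a *: u).
Proof. by move=> [P0 Pl] Pu; rewrite -[_ *: _]addr0; apply: Pl. Qed.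

Lemma subspaceD P u v : is_subspace P -> P u -> P v -> P (u + v).
Proof. by move=> [P0 Pl] Pu Pv; rewrite -[u]scale1r; apply: Pl. Qed.

Lemma subspaceB P u v : is_subspace P -> P u -> P v -> P (u - v).
Proof.
by move=> sP Pu Pv; rewrite -scaleN1r; apply: subspaceD => //; apply: subspaceZ.
Qed.

Lemma subspace_sum P (I : Type) (r : seq I) (F : I -> V) :
  is_subspace P -> (forall i, P (F i)) -> P (\sum_(i <- r) F i).
Proof.
by move=> sP PF; elim/big_rec: _ => [|i u _ Pu]; [case: sP | apply: subspaceD].
Qed.

(* The Vandermonde matrix of the distinct nodes [c k] is invertible. *)
Lemma subspace_moments P m (c : nat -> rat) (v : nat -> V) :
  is_subspace P -> {in gtn m &, injective c} ->
  (forall i, P (\sum_(k < m) c k ^+ i *: v k)) -> forall k, (k < m)%N -> P (v k).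
Proof.
move=> sP; elim: m v => // m IHm v c_inj Pv.
have Pm k : (k < m)%N -> P (v k).
  move=> km; have cN0 : c k - c m != 0.
    rewrite subr_eq0; apply/eqP => /c_inj; rewrite !inE ltnS (ltnW km) leqnn.
    by move=> /(_ isT isT) kE; rewrite kE ltnn in km.
  suff: P ((c k - c m) *: v k).
    by move=> /(subspaceZ (c k - c m)^-1 sP); rewrite scalerA mulVf ?scale1r.
  apply: (IHm (fun k => (c k - c m) *: v k)) => // [i j im jm|i].
    by apply: c_inj; rewrite inE ltnS ltnW.
  (* Moment i+1 minus [c m] times moment i loses its last term and leaves the moments of the vectors
     [(c k - c m) *: v k]. *)
  have := subspaceB sP (Pv i.+1) (subspaceZ (c m) sP (Pv i)).
  rewrite !big_ord_recr /= scalerDr scalerA -exprS opprD addrACA subrr addr0.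
  rewrite scaler_sumr -sumrB; congr P; apply: eq_bigr => j _.
  by rewrite !scalerA -scalerBl exprS mulrBr [c j * _]mulrC [c m * _]mulrC.
move=> k; rewrite ltnS leq_eqVlt => /orP[/eqP ->|]; last exact: Pm.
have := Pv 0%N; rewrite big_ord_recr /= expr0 scale1r addrC => Pvm.
rewrite -[v m](addrK (\sum_(k < m) c k ^+ 0 *: v k)); apply: subspaceB => //.
by apply: subspace_sum => // j; apply: subspaceZ => //; apply: Pm.
Qed.

(** The matrices expressing the two families in each other have product the identity of size [d],
    since [b] is free; hence the inner size [e] is at least [d]. *)
Lemma has_dim_le P d e : has_dim P d -> has_dim P e -> (d <= e)%N.
Proof.
move=> [b [b_free bP]] [b' [_ b'P]].
have bX i : exists c : 'I_e -> rat, b i = \sum_j c j *: b' j.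
  apply/b'P/bP; exists (fun j => (j == i)%:R).
  rewrite (bigD1 i) //= eqxx scale1r big1 ?addr0 // => j ji.
  by rewrite (negPf ji) scale0r.
have b'Y j : exists c : 'I_d -> rat, b' j = \sum_i c i *: b i.
  apply/bP/b'P; exists (fun i => (i == j)%:R).
  rewrite (bigD1 j) //= eqxx scale1r big1 ?addr0 // => i ij.
  by rewrite (negPf ij) scale0r.
have [X bE] := fin_all_exists bX; have [Y b'E] := fin_all_exists b'Y.
apply: (@mulmx1_min _ _ _ (\matrix_(i, j) X i j) (\matrix_(j, k) Y j k)).
apply/matrixP => i k; rewrite !mxE; apply/eqP; rewrite -subr_eq0; apply/eqP.
under eq_bigr => j _ do rewrite !mxE.
apply: (b_free (fun k => \sum_j X i j * Y j k - (i == k)%:R)) k.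
under eq_bigr => k _ do rewrite scalerBl scaler_suml.
rewrite sumrB exchange_big /=; apply/eqP; rewrite subr_eq0; apply/eqP.
transitivity (b i).
  rewrite [RHS]bE; apply: eq_bigr => j _; rewrite b'E scaler_sumr.
  by apply: eq_bigr => l _; rewrite scalerA.
rewrite (bigD1 i) //= eqxx scale1r big1 ?addr0 // => l li.
by rewrite eq_sym (negPf li) scale0r.
Qed.

Lemma has_dim_inj P d e : has_dim P d -> has_dim P e -> d = e.
Proof. by move=> Pd Pe; apply/eqP; rewrite eqn_leq !(has_dim_le Pd, has_dim_le Pe). Qed.

Lemma has_dim_subspace P d : has_dim P d -> is_subspace P.
Proof.
move=> [b [_ bP]]; split=> [|a u v /bP[c ->] /bP[e ->]]; apply/bP.
  by exists (fun=> 0); rewrite big1 // => i _; rewrite scale0r.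
exists (fun i => a * c i + e i); rewrite scaler_sumr -big_split.
by apply: eq_bigr => i _; rewrite scalerDl scalerA.
Qed.

End Subspaces.

(** * Highest weight vectors for sl_2 acting on two letters *)

Section HighestWeight.

Context {n : nat} {A : free_algebra n} (x y : 'I_n).
Context (xy : x != y) (xyP : forall i, (i == x) || (i == y)).
Implicit Types (s t v : A) (w : seq 'I_n).

Local Notation E := (@replace n A y x).
Local Notation F := (@replace n A x y).

Definition weight w : rat := (count_mem x w)%:R - (count_mem y w)%:R.

Definition weight_op : A -> A :=
  derive (fun i => (i == x)%:R *: letter x - (i == y)%:R *: letter y).

HB.instance Definition _ := GRing.isLinear.Build rat A A _ weight_op (extend_linear _).

Lemma weight_op_lin : linear weight_op.
Proof. exact: extend_linear. Qed.

Lemma weight_op_word w : weight_op (word w) = weight w *: word w.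
Proof.
have yx : (y == x) = false by rewrite eq_sym; apply: negPf.
rewrite /weight; elim: w => [|i w IHw].
  by rewrite word_nil /weight_op derive1 subrr scale0r.
rewrite word_cons /weight_op derive_letterM -/weight_op IHw free_scalerAr /=.
case/orP: (xyP i) => /eqP ->; rewrite eqxx ?yx ?(negPf xy) /= ?mulr1n ?mulr0n.
  by rewrite scale0r subr0 scale1r natrD mulr1n -addrA [RHS]scalerDl scale1r.
by rewrite scale0r sub0r scale1r add0n natrD mulr1n opprD addrCA [RHS]scalerDl scaleN1r mulNr.
Qed.

Lemma raise_lower t : E (F t) = F (E t) + weight_op t.
Proof.
have yx : (y == x) = false by rewrite eq_sym; apply: negPf.
apply/eqP; rewrite addrC -subr_eq /replace derive_commutator; apply/eqP.
apply: eq_derive => i; rewrite !linearZ /= !derive_letter !eqxx !scale1r.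
by [].
Qed.

Lemma weight_raise t : weight_op (E t) = E (weight_op t) + 2 *: E t.
Proof.
apply/eqP; rewrite addrC -subr_eq /weight_op /replace derive_commutator -derive_scale.
apply/eqP/eq_derive => i; rewrite linearB /= !linearZ /= !derive_letter.
rewrite !eqxx (negPf xy) /= mulr0n mulr1n !scale0r scaler0 !scale1r.
by rewrite subr0 add0r scalerN opprK -scalerDr -mulr2n -(scaler_nat 2).
Qed.

Lemma weight_lower t : weight_op (F t) = F (weight_op t) - 2 *: F t.
Proof.
have yx : (y == x) = false by rewrite eq_sym; apply: negPf.
apply/eqP; rewrite -scaleNr addrC -subr_eq /weight_op /replace derive_commutator.
rewrite -derive_scale; apply/eqP/eq_derive => i; rewrite linearB /= !linearZ /= !derive_letter.
rewrite !eqxx yx /= mulr0n mulr1n !scale0r !scale1r.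
rewrite oppr0 scaler0 addr0 sub0r scalerN -opprD -scalerDr -mulr2n scaleNr scalerN.
by rewrite -(scaler_nat 2).
Qed.

Lemma iter_replace_word p q k w : p != q -> (size w < k)%N ->
  iter k (replace p q) (word w) = 0 :> A.
Proof.
move=> pq; elim: w k => [|i w IHw] [//|k] /= wk.
  rewrite -iterS iterSr word_nil [X in iter _ _ X]derive1.
  by elim: k {wk} => //= k ->; rewrite linear0.
rewrite -iterS word_cons iter_replace_letterM // (IHw k.+1) ?(ltnW wk) //.
by rewrite [k.+1.-1]/= IHw // !mulr0 !scaler0 addr0.
Qed.

Lemma iter_replace_size p q m k t : p != q -> (m < k)%N ->
  (forall w, coord w t != 0 -> size w == m) -> iter k (replace p q) t = 0.
Proof.
move=> pq mk; apply: (supp_ext (h := fun=> 0)) => [||w /eqP wm].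
- exact: iter_lin (replace_lin p q).
- exact: zero_lin.
by rewrite iter_replace_word // wm.
Qed.

Lemma weight_raise_iter (m : rat) k t :
  weight_op t = m *: t -> weight_op (iter k E t) = (m + 2 * k%:R) *: iter k E t.
Proof.
move=> tm; elim: k => [|k IHk]; first by rewrite mulr0 addr0.
rewrite iterS weight_raise IHk linearZ -scalerDl; congr (_ *: _).
by rewrite -natr1; ring.
Qed.

Lemma weight_lower_iter (m : rat) k t :
  weight_op t = m *: t -> weight_op (iter k F t) = (m - 2 * k%:R) *: iter k F t.
Proof.
move=> tm; elim: k => [|k IHk]; first by rewrite mulr0 subr0.
rewrite iterS weight_lower IHk linearZ -scalerBl; congr (_ *: _).
by rewrite -natr1; ring.
Qed.

(** Moving E past each F adds the weight of the vector in between; the weights m, m-2, ..., m-2k add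
    up to this coefficient. *)
Lemma raise_lower_iter (m : rat) k t : weight_op t = m *: t -> E t = 0 ->
  E (iter k.+1 F t) = (k.+1%:R * (m - k%:R)) *: iter k F t.
Proof.
move=> tm Et; elim: k => [|k IHk].
  by rewrite raise_lower Et linear0 add0r tm subr0 mul1r.
rewrite iterS raise_lower IHk linearZ (weight_lower_iter k.+1 tm) -scalerDl /=.
by congr (_ *: _); rewrite -!natr1; ring.
Qed.

(** On a fixed length the number of letters [y] determines the weight, so this is the projection to
    a weight space. *)
Definition weight_part j : A -> A :=
  extend (fun w => if count_mem y w == j then word w else 0).

HB.instance Definition _ j :=
  GRing.isLinear.Build rat A A _ (weight_part j) (extend_linear _).

Lemma weight_part_word j w : weight_part j (word w) = (count_mem y w == j)%:R *: word w.
Proof. by rewrite /weight_part extend_word; case: eqP; rewrite ?scale1r ?scale0r. Qed.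

Lemma weightE w : weight w = (size w)%:R - 2 * (count_mem y w)%:R.
Proof.
suff -> : size w = (count_mem x w + count_mem y w)%N by rewrite /weight natrD; ring.
elim: w => //= i w ->; have yx : (y == x) = false by rewrite eq_sym; apply: negPf.
by case/orP: (xyP i) => /eqP ->; rewrite eqxx ?yx ?(negPf xy) ?addSn ?addnS.
Qed.

Lemma weight_op_part j m t : (forall w, coord w t != 0 -> size w == m) ->
  weight_op (weight_part j t) = (m%:R - 2 * j%:R) *: weight_part j t.
Proof.
apply: (supp_ext (f := fun t => weight_op _) (h := fun t => _ *: _)) => [||w /eqP <-].
- exact: comp_lin weight_op_lin (extend_linear _).
- by apply: scale_lin; apply: extend_linear.
rewrite weight_part_word; have [<-|_] := eqVneq; last by rewrite scale0r linear0 scaler0.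
by rewrite !scale1r weight_op_word weightE.
Qed.

Lemma sum_weight_part m t : (forall w, coord w t != 0 -> size w == m) ->
  t = \sum_(j < m.+1) weight_part j t.
Proof.
apply: (supp_ext (f := id) (h := fun t => \sum_(j < m.+1) weight_part j t)) => [||w].
- by [].
- by apply: sum_lin => j; apply: extend_linear.
move=> /eqP wm; have jm : (count_mem y w < m.+1)%N by rewrite ltnS -wm count_size.
rewrite (bigD1 (Ordinal jm)) //= weight_part_word eqxx scale1r big1 ?addr0 // => j ji.
rewrite weight_part_word; case: eqP => [wj|_]; last by rewrite scale0r.
by case/eqP: ji; apply: val_inj.
Qed.

Definition shear_stable (W : A -> Prop) : Prop := forall (a : rat) t, W t ->
  W (act (shear x y a) t) /\ W (act (shear y x a) t).

(** A shear is polynomial in its parameter, with linear coefficient [replace p q]. At the parameter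
    2^i the coefficients appear with the i-th powers of the nodes 2^k, so [subspace_moments]
    extracts them. *)
Lemma replace_stable (W : A -> Prop) m t : is_subspace W ->
  (forall s, W s -> forall w, coord w s != 0 -> size w == m) -> shear_stable W ->
  W t -> W (E t) /\ W (F t).
Proof.
move=> sW Wm shW Wt; have yx : y != x by rewrite eq_sym.
have expW p q : p != q -> (forall a, W (act (shear p q a) t)) -> W (replace p q t).
  (* In length 0 the expansion stops before its linear term, but there the operator is zero. *)
  move=> pq Wpq; case: m Wm => [|m] Wm.
    rewrite -[replace p q t]/(iter 1 (replace p q) t).
    by rewrite (iter_replace_size pq _ (Wm t Wt)) //; case: sW.
  have -> : replace p q t = (1`!%:R^-1 : rat) *: iter 1 (replace p q) t.
    by rewrite factS fact0 invr1 scale1r.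
  have := subspace_moments (m := m.+2) (c := fun k => 2 ^+ k)
    (v := fun k => k`!%:R^-1 *: iter k (replace p q) t) sW.
  apply=> [i j _ _|i|//]; first exact: (@ieexprIn rat 2).
  have := Wpq (2 ^+ i); rewrite (act_shear _ pq (Wm t Wt)).
  by congr W; apply: eq_bigr => k _; rewrite exprAC.
by split; apply: expW => // a; case: (shW a t Wt).
Qed.

Lemma stable_shear (W : A -> Prop) m : is_subspace W ->
  (forall s, W s -> forall w, coord w s != 0 -> size w == m) ->
  (forall t, W t -> W (E t) /\ W (F t)) -> shear_stable W.
Proof.
move=> sW Wm stW a t Wt; have yx : y != x by rewrite eq_sym.
rewrite !(act_shear _ _ (Wm t Wt)) //.
by split; apply: subspace_sum => // k; do 2!apply: subspaceZ => //;
  elim: (nat_of_ord k) => //= l /stW[].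
Qed.

(** A weight component of [t] is raised until the last nonzero vector. Its lowering string spans a
    stable subspace, which irreducibility makes all of [V], and the length of the string gives both
    the weight and the dimension. *)
Lemma irreducible_highest_weight (V : A -> Prop) m d : is_subspace V ->
  (forall s, V s -> forall w, coord w s != 0 -> size w == m) -> shear_stable V ->
  (exists t, V t /\ t <> 0) ->
  (forall W, is_subspace W -> shear_stable W -> (forall t, W t -> V t) ->
     (forall t, W t -> t = 0) \/ (forall t, V t -> W t)) ->
  has_dim V d.+1 ->
  exists v, [/\ V v, v <> 0, E v = 0 & weight_op v = d%:R *: v].
Proof.
move=> sV Vm shV [t [Vt t0]] irrV dimV; have yx : y != x by rewrite eq_sym.
have stV s : V s -> V (E s) /\ V (F s) by apply: (replace_stable sV Vm).
have iterE k s : V s -> V (iter k E s) by move=> Vs; elim: k => //= k /stV[].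
have iterF k s : V s -> V (iter k F s) by move=> Vs; elim: k => //= k /stV[].
have partV j : V (weight_part j t).
  have [jm|jm] := ltnP j m.+1; last first.
    rewrite (_ : weight_part j t = 0); first by case: sV.
    apply: (supp_ext (h := fun=> 0) (P := fun w => size w == m)) (Vm t Vt) => [||w].
    - exact: extend_linear.
    - exact: zero_lin.
    move=> /eqP wm; rewrite weight_part_word; case: eqP => [wj|_]; last by rewrite scale0r.
    by move: jm; rewrite -wj -wm ltnNge count_size.
  apply: (subspace_moments (m := m.+1) (c := fun j => m%:R - 2 * j%:R)
    (v := fun j => weight_part j t) sV) jm => [i k _ _|i].
    move/addrI/oppr_inj/mulfI => /(_ isT)/eqP; rewrite eqr_nat; exact: eqP.
  (* The moments of the weight components are the iterates of the weight operator on [t], and these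
     stay in [V] since that operator is the commutator of E and F. *)
  rewrite (_ : \sum_(k < _) _ = iter i weight_op t).
    elim: i => //= i; set s := iter i _ _ => Vs.
    have [Es Fs] := stV s Vs; have [EFs _] := stV _ Fs; have [_ FEs] := stV _ Es.
    by rewrite -[weight_op s](addKr (F (E s))) -raise_lower addrC; apply: subspaceB.
  rewrite {2}(sum_weight_part (Vm t Vt)).
  elim: i => [|i IHi]; first by apply: eq_bigr => k _; rewrite scale1r.
  rewrite iterS -IHi linear_sum; apply: eq_bigr => k _ /=.
  by rewrite linearZ /= (weight_op_part _ (Vm t Vt)) scalerA exprSr.
case: (pickP (fun j : 'I_m.+1 => weight_part j t != 0)) => [j|part0]; last first.
  case: t0; rewrite (sum_weight_part (Vm t Vt)) big1 // => j _.
  exact/eqP/negbFE/part0.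
move: (nat_of_ord j) => {}j partN0.
have hE := weight_op_part j (Vm t Vt).
move: hE (partV j) partN0; set c := _ - _ : rat; move: c => c.
move: (weight_part j t) => {t t0 partV Vt j} t hE Vt tN0.
have [k /eqP kE kmin] : exists2 k, iter k E t == 0 & forall l, iter l E t == 0 -> (k <= l)%N.
  have /ex_minnP[k kE kmin] : exists k, iter k E t == 0.
    by exists m.+1; rewrite (iter_replace_size yx _ (Vm t Vt)).
  by exists k.
case: k kE kmin => [|k] kE kmin; first by rewrite [iter _ _ _]/= in kE; rewrite kE eqxx in tN0.
have := weight_raise_iter k hE; have := iterE k t Vt.
have : iter k E t != 0 by apply/negP => /kmin; rewrite ltnn.
move: kE; rewrite iterS; move: (c + _) (iter k E t) => {k kmin t hE Vt tN0} {}c v Ev vN0 Vv hv.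
have [r rF rmin] : exists2 r, iter r F v == 0 & forall l, iter l F v == 0 -> (r <= l)%N.
  have /ex_minnP[r rF rmin] : exists r, iter r F v == 0.
    by exists m.+1; rewrite (iter_replace_size xy _ (Vm v Vv)).
  by exists r.
have FN0 i : (i < r)%N -> iter i F v != 0 by move=> ir; apply/negP => /rmin; rewrite leqNgt ir.
case: r rF rmin FN0 => [|r] rF rmin FN0; first by rewrite (negPf vN0) in rF.
(* Raising the vanishing end of the string gives [(r + 1) (c - r)] times its last nonzero vector. *)
have cE : c = r%:R.
  have := raise_lower_iter r hv Ev; rewrite (eqP rF) linear0 => /esym/eqP.
  rewrite scaler_eq0 (negPf (FN0 _ (ltnSn r))) orbF mulf_eq0 pnatr_eq0 /= subr_eq0.
  by move/eqP.
pose S s := exists b : 'I_r.+1 -> rat, s = \sum_i b i *: iter i F v.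
have S_iter i : S (iter i F v).
  have [ir|ir] := ltnP i r.+1.
    exists (fun j => (j == Ordinal ir)%:R); rewrite (bigD1 (Ordinal ir)) //= eqxx scale1r.
    by rewrite big1 ?addr0 // => j ji; rewrite (negPf ji) scale0r.
  exists (fun=> 0); rewrite big1 => [|j _]; last by rewrite scale0r.
  rewrite -(subnK ir) iterD (eqP rF); elim: (i - r.+1)%N => //= l ->.
  exact: linear0.
have dimS : has_dim S r.+1.
  exists (fun i : 'I_r.+1 => iter i F v); split=> // b b0 i.
  (* [subspace_moments] takes sequences indexed by all naturals, so the coefficients are extended by
     zero. It is applied to the zero subspace, the string having pairwise distinct weights. *)
  pose b' j := if insub j is Some k then b k else 0.
  have b'E (j : 'I_r.+1) : b' j = b j by rewrite /b' valK.
  have: b' i *: iter i F v = 0.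
    apply: (subspace_moments (P := fun s => s = 0) (m := r.+1)
      (c := fun j => c - 2 * j%:R) (v := fun j => b' j *: iter j F v)) => //.
    - by split=> // e s s' -> ->; rewrite scaler0 addr0.
    - move=> j l _ _; move/addrI/oppr_inj/mulfI => /(_ isT)/eqP; rewrite eqr_nat.
      exact: eqP.
    move=> l; rewrite (_ : \sum_(_ < _) _ = iter l weight_op 0).
      by elim: l => //= l ->; rewrite linear0.
    rewrite -[X in iter _ _ X]b0; elim: l => [|l IHl].
      by apply: eq_bigr => j _; rewrite scale1r b'E.
    rewrite iterS -IHl linear_sum; apply: eq_bigr => j _ /=.
    by rewrite !linearZ /= (weight_lower_iter j hv) !scalerA exprSr mulrCA mulrA.
  by move/eqP; rewrite scaler_eq0 (negPf (FN0 _ (ltn_ord i))) orbF b'E => /eqP.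
have sS := has_dim_subspace dimS.
have SV s : S s -> V s.
  by move=> [b ->]; apply: subspace_sum => // i; apply: subspaceZ => //; apply: iterF.
have stS s : S s -> S (E s) /\ S (F s).
  move=> [b ->]; rewrite !linear_sum; split; apply: subspace_sum => // i;
    rewrite linearZ; apply: subspaceZ => //; last exact: S_iter i.+1.
  case: i => -[|i] i_r /=; first by rewrite Ev; case: sS.
  by rewrite (raise_lower_iter i hv Ev); apply: subspaceZ.
have shS : shear_stable S by apply: (stable_shear sS _ stS) => s /SV; apply: Vm.
case: (irrV S sS shS SV) => [S0|VS].
  by rewrite (S0 v (S_iter 0%N)) eqxx in vN0.
exists v; split=> //; first exact/eqP.
have dimVr : has_dim V r.+1.
  have [b [b_free bS]] := dimS; exists b; split=> // s; rewrite -bS.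
  by split=> [/VS|/SV].
by rewrite hv cE; congr (_%:R *: _); case: (has_dim_inj dimVr dimV).
Qed.

End HighestWeight.

(** * Shuffles and Lie elements *)

Fixpoint shuffle {T : Type} (u : seq T) : seq T -> seq (seq T) :=
  if u is a :: u' then
    fix shuffle_u v :=
      if v is b :: v' then map (cons a) (shuffle u' v) ++ map (cons b) (shuffle_u v')
      else [:: u]
  else fun v => [:: v].

Lemma shuffle_nilr {T : Type} (u : seq T) : shuffle u [::] = [:: u].
Proof. by case: u. Qed.

Lemma map_shuffle {T U : Type} (f : T -> U) u v :
  shuffle (map f u) (map f v) = map (map f) (shuffle u v).
Proof.
elim: u v => [|a u IHu] //; elim=> [|b v IHv] //=.
rewrite map_cat -!map_comp; congr (_ ++ _).
  by rewrite -[f b :: _]/(map f (b :: v)) IHu -map_comp.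
by move: IHv => /= ->; rewrite -map_comp.
Qed.

Definition lie_element {n} {A : free_algebra n} : A -> Prop :=
  lie_generated (fun a b => a * b - b * a) (fun s => exists i, s = letter i).

Section LieElements.

Context {n : nat} {A : free_algebra n}.
Implicit Types (a b f t : A) (u v w : seq 'I_n) (i j : 'I_n).

Definition shuffle_coord u v t : rat := \sum_(w <- shuffle u v) coord w t.

(** Ree's condition: linear equations on coordinates that every Lie element satisfies. *)
Definition primitive t : Prop := coord [::] t = 0 /\
  forall u v, u != [::] -> v != [::] -> shuffle_coord u v t = 0.

Lemma shuffle_coord_lin u v : linear (shuffle_coord u v : A -> rat^o).
Proof. by apply: sum_lin => w; apply: coord_linear. Qed.

Lemma shuffle_coordP u v (c : rat) s t :
  shuffle_coord u v (c *: s + t) = c * shuffle_coord u v s + shuffle_coord u v t.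
Proof. exact: shuffle_coord_lin. Qed.

Lemma shuffle_coord0 u v : shuffle_coord u v (0 : A) = 0.
Proof. by rewrite /shuffle_coord big1 // => w _; rewrite linear0. Qed.

Lemma shuffle_coord_nill v t : shuffle_coord [::] v t = coord v t.
Proof. exact: big_seq1. Qed.

Lemma shuffle_coord_nilr u t : shuffle_coord u [::] t = coord u t.
Proof. by rewrite /shuffle_coord shuffle_nilr big_seq1. Qed.

Lemma shuffle_coord_cons i j u v t : shuffle_coord (i :: u) (j :: v) t =
  shuffle_coord u (j :: v) (tail i t) + shuffle_coord (i :: u) v (tail j t).
Proof.
rewrite /shuffle_coord big_cat !big_map; congr (_ + _);
  by apply: eq_bigr => w _; rewrite coord_tail.
Qed.

Lemma shuffle_coord_letter i u v : u != [::] -> v != [::] ->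
  shuffle_coord u v (letter i : A) = 0.
Proof.
case: u v => [|j u] [|k v] // _ _; rewrite shuffle_coord_cons /letter !tail_cons.
have S1 u' v' : (0 < size u' + size v')%N -> shuffle_coord u' v' (word [::] : A) = 0.
  case: u' v' => [|i' u'] [|j' v'] // _; rewrite ?shuffle_coord_nill ?shuffle_coord_nilr.
  - by rewrite coord_word.
  - by rewrite coord_word.
  by rewrite shuffle_coord_cons !tail_nil !shuffle_coord0 addr0.
have S0 (c : rat) u' v' : (0 < size u' + size v')%N ->
    shuffle_coord u' v' (c *: word [::] : A) = 0.
  by move=> uv; rewrite -[c *: _]addr0 shuffle_coordP S1 // mulr0 shuffle_coord0 addr0.
by rewrite !S0 ?addr0 //= addnS.
Qed.

Definition convolve f (G : seq 'I_n -> rat) v : rat :=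
  \sum_(p < (size v).+1) G (take p v) * coord (drop p v) f.

Lemma convolve_cons f G j v : convolve f G (j :: v) =
  G [::] * coord (j :: v) f + convolve f (fun v' => G (j :: v')) v.
Proof. by rewrite /convolve big_ord_recl. Qed.

Lemma convolve0 f G v : (forall u, G u = 0) -> convolve f G v = 0.
Proof. by move=> G0; apply: big1 => p _; rewrite G0 mul0r. Qed.

Lemma convolveD f G H v :
  convolve f (fun u => G u + H u) v = convolve f G v + convolve f H v.
Proof. by rewrite -big_split; apply: eq_bigr => p _; apply: mulrDl. Qed.

Lemma coordM v a f : coord v (a * f) = convolve f (fun u => coord u a) v.
Proof.
elim: v a => [|j v IHv] a; first by rewrite coord_nilM /convolve big_ord1.
rewrite -coord_tail tailM coordD IHv coordZ coord_tail convolve_cons addrC.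
by congr (_ + _); apply: eq_bigr => p _; rewrite coord_tail.
Qed.

(** Shuffling is dual to the coproduct for which the letters are primitive; the two terms are the
    coproduct of [a] multiplied by 1 (x) f and by f (x) 1. The recursion on letters avoids forming
    the tensor square. *)
Lemma shuffle_coordM u v a f : primitive f -> shuffle_coord u v (a * f) =
  convolve f (fun v' => shuffle_coord u v' a) v +
  convolve f (fun u' => shuffle_coord u' v a) u.
Proof.
move=> [f0 fS]; elim: u v a => [|i u IHu].
  move=> v a; rewrite shuffle_coord_nill coordM [X in _ + X]big_ord1 f0 mulr0 addr0.
  by apply: eq_bigr => p _; rewrite shuffle_coord_nill.
elim=> [|j v IHv] a.
  rewrite shuffle_coord_nilr coordM [X in X + _]big_ord1 f0 mulr0 add0r.
  by apply: eq_bigr => p _; rewrite shuffle_coord_nilr.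
(* The constant term of [a] contributes a multiple of a shuffle coordinate of [f] itself, which is
   zero. *)
have fE : shuffle_coord u (j :: v) (tail i f) + shuffle_coord (i :: u) v (tail j f) = 0.
  by rewrite -shuffle_coord_cons fS.
rewrite shuffle_coord_cons !tailM ![_ * f + _]addrC !shuffle_coordP.
rewrite addrACA -mulrDr fE mulr0 add0r {}IHu {}IHv !convolve_cons.
rewrite !shuffle_coord_nilr !shuffle_coord_nill -!coord_tail.
have -> : convolve f (fun v' => shuffle_coord (i :: u) (j :: v') a) v =
    convolve f (fun v' => shuffle_coord u (j :: v') (tail i a)) v +
    convolve f (fun v' => shuffle_coord (i :: u) v' (tail j a)) v.
  by rewrite -convolveD; apply: eq_bigr => p _; rewrite shuffle_coord_cons.
have -> : convolve f (fun u' => shuffle_coord (i :: u') (j :: v) a) u =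
    convolve f (fun u' => shuffle_coord u' (j :: v) (tail i a)) u +
    convolve f (fun u' => shuffle_coord (i :: u') v (tail j a)) u.
  by rewrite -convolveD; apply: eq_bigr => p _; rewrite shuffle_coord_cons.
ring.
Qed.

(** On a product of two primitive elements a proper shuffle coordinate is symmetric in the factors,
    so it cancels in the commutator. *)
Lemma primitive_commutator a b : primitive a -> primitive b -> primitive (a * b - b * a).
Proof.
have prodE u v c d : u != [::] -> v != [::] -> primitive c -> primitive d ->
    shuffle_coord u v (c * d) = coord u c * coord v d + coord v c * coord u d.
  case: u v => [|i u] [|j v] // _ _ [_ cS] dp; rewrite shuffle_coordM // !convolve_cons.
  rewrite shuffle_coord_nilr shuffle_coord_nill !convolve0 ?addr0 // => w; exact: cS.
move=> ap bp; split=> [|u v u0 v0].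
  by rewrite linearB /= !coord_nilM; case: ap bp => -> _ [-> _]; rewrite !mul0r subr0.
rewrite -scaleN1r addrC shuffle_coordP !prodE //; ring.
Qed.

Lemma lie_primitive t : lie_element t -> primitive t.
Proof.
elim=> [_ [i ->]||c s {}t _ [s0 sS] _ [t0 tS]|s {}t _ ps _ pt].
- split=> [|u v u0 v0]; first by rewrite coord_word.
  exact: shuffle_coord_letter.
- by split=> [|u v _ _]; rewrite ?linear0 ?shuffle_coord0.
- split=> [|u v u0 v0]; first by rewrite coordP s0 t0 mulr0 addr0.
  by rewrite shuffle_coordP sS // tS // mulr0 addr0.
exact: primitive_commutator.
Qed.

Lemma tail_symplectic_derivation (f : 'I_n -> A) i :
  tail i (\sum_j letter j * f j) = f i.
Proof.
rewrite linear_sum (bigD1 i) //= tail_letter eqxx scale1r big1 ?addr0 // => j ji.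
by rewrite tail_letter (negPf ji) scale0r.
Qed.

(** The sum of the products [f j * letter j] is the rotation of the tensor, so the vanishing of the
    bracket is exactly cyclic invariance. *)
Lemma coord_rot_derivation (f : 'I_n -> A) i w :
  \sum_j (letter j * f j - f j * letter j) = 0 ->
  coord (rcons w i) (\sum_j letter j * f j) = coord (i :: w) (\sum_j letter j * f j).
Proof.
rewrite sumrB => /subr0_eq fE; rewrite -coord_tail tail_symplectic_derivation fE.
rewrite linear_sum (bigD1 i) //= coord_rcons eqxx mul1r big1 ?addr0 // => j ji.
by rewrite coord_rcons (negPf ji) mul0r.
Qed.

End LieElements.

(** * Certified elimination over binary integers, and necklaces *)

Definition rat_of_Z (z : Z) : rat := (int_of_Z z)%:~R.

Lemma rat_of_ZD a b : rat_of_Z (Z.add a b) = rat_of_Z a + rat_of_Z b.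
Proof. by rewrite /rat_of_Z -[Z.add a b]/(a + b : Z) !rmorphD. Qed.

Lemma rat_of_ZM a b : rat_of_Z (Z.mul a b) = rat_of_Z a * rat_of_Z b.
Proof. by rewrite /rat_of_Z -[Z.mul a b]/(a * b : Z) !rmorphM. Qed.

Lemma rat_of_ZB a b : rat_of_Z (Z.sub a b) = rat_of_Z a - rat_of_Z b.
Proof. by rewrite /rat_of_Z -[Z.sub a b]/(a - b : Z) !rmorphB. Qed.

Lemma rat_of_Z_eq0 a : (rat_of_Z a == 0) = Z.eqb a 0.
Proof.
rewrite /rat_of_Z intr_eq0; apply/eqP/Z.eqb_spec => [|->] //.
by move=> a0; rewrite -[a]int_of_ZK a0.
Qed.

Lemma rat_of_nat k : rat_of_Z (Z.of_nat k) = k%:R.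
Proof. by elim: k => // k IHk; rewrite Nat2Z.inj_succ -Z.add_1_r rat_of_ZD IHk -natr1. Qed.

Definition dot (r : seq Z) (z : seq rat) : rat :=
  \sum_(p <- zip r z) rat_of_Z p.1 * p.2.

(** Fraction-free row step: cross multiplication by the leading entries, divided by their gcd to
    limit coefficient growth. The pivot row itself becomes zero. *)
Definition eliminate (p r : seq Z) : seq Z :=
  let a := head Z0 p in let b := head Z0 r in
  if Z.eqb b 0 then behead r else
  let g := Z.gcd a b in let a' := Z.div a g in let b' := Z.div b g in
  [seq Z.sub (Z.mul a' q.2) (Z.mul b' q.1) | q <- zip (behead p) (behead r)].

(* Decides by Gaussian elimination that a homogeneous linear system in [n]
   unknowns has no nonzero rational solution. *)
Fixpoint nonsingular (n : nat) (rows : seq (seq Z)) : bool :=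
  if n is n'.+1 then
    if [seq r <- rows | ~~ Z.eqb (head Z0 r) 0] is p :: _
    then nonsingular n' [seq eliminate p r | r <- rows] else false
  else true.

Lemma dot_cons a r b z : dot (a :: r) (b :: z) = rat_of_Z a * b + dot r z.
Proof. exact: big_cons. Qed.

Lemma dot_zip a b p r z : size p = size z -> size r = size z ->
  dot [seq Z.sub (Z.mul a q.2) (Z.mul b q.1) | q <- zip p r] z =
  rat_of_Z a * dot r z - rat_of_Z b * dot p z.
Proof.
elim: z p r => [|c z IHz] [|d p] [|e r] //= => [_ _|[pz] [rz]].
  by rewrite /dot !big_nil !mulr0 subr0.
by rewrite !dot_cons IHz // rat_of_ZB !rat_of_ZM; ring.
Qed.

Lemma nonsingularP rows z : all (fun r => size r == size z) rows ->
  nonsingular (size z) rows -> (forall r, r \in rows -> dot r z = 0) ->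
  z = nseq (size z) 0.
Proof.
elim: z rows => [|c z IHz] rows //= /allP size_rows.
case rowsE : [seq r <- rows | _] => [//|p ps] nons dot0.
have: p \in [seq r <- rows | ~~ Z.eqb (head Z0 r) 0] by rewrite rowsE mem_head.
rewrite mem_filter => /andP[a0 p_rows].
case: p p_rows a0 (size_rows _ p_rows) (dot0 _ p_rows) {rowsE} nons => [//|a p] p_rows /= a0.
rewrite eqSS => /eqP sp; rewrite dot_cons => dotp nons.
have z0 : z = nseq (size z) 0.
  apply: (IHz [seq eliminate (a :: p) r | r <- rows]) => //.
    apply/allP => _ /mapP[r /size_rows sr ->].
    case: r sr => // b r; rewrite eqSS /eliminate /= => /eqP sr.
    have {}sr : size r = size z := sr; case: ifP => _ /=; first by rewrite sr.
    by rewrite size_map size_zip sp sr minnn.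
  move=> _ /mapP[r r_rows ->]; have := size_rows _ r_rows; have := dot0 _ r_rows.
  case: r {r_rows} => // b r; rewrite eqSS dot_cons /eliminate /= => dotr /eqP sr.
  case: ifP => [b0|_].
    by move: dotr; rewrite (eqP (_ : rat_of_Z b == 0)) ?rat_of_Z_eq0 // mul0r add0r.
  rewrite dot_zip //.
  have -> : dot r z = - (rat_of_Z b * c) by apply/eqP; rewrite -addr_eq0 addrC dotr.
  have -> : dot p z = - (rat_of_Z a * c) by apply/eqP; rewrite -addr_eq0 addrC dotp.
  have ab : rat_of_Z (Z.div a (Z.gcd a b)) * rat_of_Z b =
            rat_of_Z (Z.div b (Z.gcd a b)) * rat_of_Z a.
    rewrite -!rat_of_ZM; congr rat_of_Z.
    have [a' aE] := Z.gcd_divide_l a b; have [b' bE] := Z.gcd_divide_r a b.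
    have g0 : Z.gcd a b <> Z0.
      by move/Z.gcd_eq_0_l => a_0; rewrite a_0 in a0.
    have -> : Z.div a (Z.gcd a b) = a' by rewrite {1}aE Z.div_mul.
    have -> : Z.div b (Z.gcd a b) = b' by rewrite {1}bE Z.div_mul.
    by rewrite [in LHS]bE [in RHS]aE !Z.mul_assoc (Z.mul_comm a' b').
  by rewrite !mulrN !mulrA ab subrr.
rewrite z0 size_nseq; congr (_ :: _).
move: dotp; rewrite z0 /dot big1_seq ?addr0 => [/eqP|q].
  by rewrite mulf_eq0 rat_of_Z_eq0 (negPf a0) => /eqP.
move=> /andP[_ q_zip]; have : q.2 \in unzip2 (zip p (nseq (size z) 0)) by apply: map_f.
by rewrite unzip2_zip ?size_nseq ?sp // => /nseqP[-> _]; rewrite mulr0.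
Qed.

(* [false] stands for the letter [x] and [true] for [y]; [flips w] are the words
   whose images under raising ([y] to [x]) contain [w]. *)
Fixpoint flips (w : seq bool) : seq (seq bool) :=
  if w is b :: w' then
    (if b then [::] else [:: true :: w']) ++ [seq b :: u | u <- flips w']
  else [::].

Fixpoint lex_le (u v : seq bool) : bool :=
  match u, v with
  | b :: u', c :: v' => if b == c then lex_le u' v' else c
  | _, _ => true
  end.

(** The lexicographically least rotation. Soundness rests on its being some rotation; minimality
    makes it constant on rotation classes, which the check needs to succeed. *)
Definition necklace (w : seq bool) : seq bool :=
  foldr (fun k v => if lex_le (rot k w) v then rot k w else v) w (iota 0 (size w)).

Fixpoint binary_words (m q : nat) : seq (seq bool) :=
  if m is m'.+1 then
    [seq false :: w | w <- binary_words m' q] ++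
    (if q is q'.+1 then [seq true :: w | w <- binary_words m' q'] else [::])
  else if q is 0 then [:: [::]] else [::].

Definition necklaces (m q : nat) : seq (seq bool) :=
  [seq w <- binary_words m q | necklace w == w].

(* Decides that a function on binary words of length [m] with [q] letters [y]
   which is invariant under rotation and has zero sum over each of the lists in
   [sys] vanishes. *)
Definition determines (m q : nat) (sys : seq (seq (seq bool))) : bool :=
  let reps := necklaces m q in
  let rels := [seq [seq necklace w | w <- rel] | rel <- sys] in
  [&& uniq reps, all (fun w => necklace w \in reps) (binary_words m q),
      all (all (mem reps)) rels &
      nonsingular (size reps)
        [seq [seq Z.of_nat (count_mem r rel) | r <- reps] | rel <- rels]].

Lemma necklace_rot (w : seq bool) : exists k, necklace w = rot k w.
Proof.
rewrite /necklace; elim: (iota _ _) => [|k r [l IHr]] /=; first by exists 0%N; rewrite rot0.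
by case: ifP => _; [exists k | exists l].
Qed.

Lemma mem_binary_words m q w : size w = m -> count id w = q -> w \in binary_words m q.
Proof.
elim: w m q => [|b w IHw] m q; first by move=> <- <-.
case: m => //= m [] sw; rewrite mem_cat; case: b => /= [<-|].
  by rewrite add1n (map_f (cons true)) ?orbT // IHw.
by rewrite add0n => cw; rewrite (map_f (cons false)) // IHw.
Qed.

Lemma sum_count (T : eqType) (reps s : seq T) (F : T -> rat) :
  uniq reps -> all (mem reps) s ->
  \sum_(r <- reps) (count_mem r s)%:R * F r = \sum_(c <- s) F c.
Proof.
move=> reps_uniq; elim: s => [|c s IHs] /=.
  by rewrite big_nil big1 // => r _; rewrite mul0r.
move=> /andP[c_reps s_reps]; rewrite big_cons -IHs // (eq_bigr (fun r =>
  (c == r)%:R * F r + (count_mem r s)%:R * F r)) => [|r _]; last first.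
  by rewrite natrD mulrDl.
rewrite big_split /= (bigD1_seq c) //= eqxx mul1r big1 ?addr0 // => r.
by rewrite eq_sym => /negPf ->; rewrite mul0r.
Qed.

(** Rotation invariance leaves the values at necklaces as unknowns, and a relation becomes the
    integer row of multiplicities of the necklaces among its words. *)
Lemma determinesP m q sys (F : seq bool -> rat) : determines m q sys ->
  (forall k w, F (rot k w) = F w) ->
  (forall rel, rel \in sys -> \sum_(w <- rel) F w = 0) ->
  forall w, size w = m -> count id w = q -> F w = 0.
Proof.
move=> /and4P[reps_uniq /allP all_reps rels_reps nons] Frot Fsys w wm wq.
have Fneck u : F (necklace u) = F u by have [k ->] := necklace_rot u.
set reps := necklaces m q in reps_uniq all_reps rels_reps nons.
have dotE (c : seq bool -> Z) r : dot (map c r) (map F r) = \sum_(u <- r) rat_of_Z (c u) * F u.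
  by elim: r => [|u r IHr]; rewrite /dot ?big_nil //= !big_cons -IHr.
have: [seq F r | r <- reps] = nseq (size [seq F r | r <- reps]) 0.
  rewrite -(size_map F reps) in nons; apply: nonsingularP nons _.
    by apply/allP => _ /mapP[rel _ ->]; rewrite !size_map.
  move=> _ /mapP[_ /mapP[rel rel_sys ->] ->]; rewrite dotE.
  under eq_bigr => r _ do rewrite rat_of_nat.
  rewrite sum_count //; last by apply: (allP rels_reps); apply: map_f.
  by rewrite big_map -[RHS](Fsys _ rel_sys); apply: eq_bigr => u _; apply: Fneck.
rewrite size_map => F0; rewrite -Fneck.
have /(map_f F) := all_reps _ (mem_binary_words wm wq).
by rewrite F0 => /nseqP[].
Qed.

(** * Tensors in two letters determined by linear relations *)

Section BinaryWords.

Context {n : nat} {A : free_algebra n} (x y : 'I_n).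
Context (xy : x != y) (xyP : forall i, (i == x) || (i == y)).
Implicit Types (s t : A) (w : seq bool).

Definition binary_letter (b : bool) : 'I_n := if b then y else x.

Local Notation wd := (map binary_letter).

Lemma binary_letterP i : binary_letter (i == y) = i.
Proof.
by rewrite /binary_letter; case: (i =P y) (xyP i) => [->|_] //; rewrite orbF => /eqP.
Qed.

Lemma binary_wordP (w : seq 'I_n) : wd [seq i == y | i <- w] = w.
Proof. by rewrite -map_comp map_id_in // => i _; apply: binary_letterP. Qed.

Lemma binary_coord_ext s t :
  (forall w, coord (wd w) s = coord (wd w) t) -> s = t.
Proof. by move=> st; apply: coord_inj => w; rewrite -(binary_wordP w). Qed.

Lemma coord_nil_derive (d : 'I_n -> A) t :
  (forall i, coord [::] (d i) = 0) -> coord [::] (derive d t) = 0.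
Proof.
move=> d0; move: t; apply: (@tensor_ext _ _ rat^o) => [||[|i w]].
- exact: comp_lin (coord_linear _) (derive_lin d).
- exact: zero_lin.
- by rewrite word_nil derive1 linear0.
by rewrite word_cons derive_letterM coordD coord_nil_letter coord_nilM d0 mul0r addr0.
Qed.

Lemma tail_replace p q i t : tail i (replace p q t : A) =
  (q == i)%:R *: tail p t + replace p q (tail i t).
Proof.
rewrite /replace tail_derive => [|k]; last by rewrite coordZ coord_word mulr0.
congr (_ + _); rewrite (bigD1 p) //= big1 => [|k kp]; last first.
  by rewrite (negPf kp) scale0r linear0 mul0r.
by rewrite eqxx scale1r /letter tail_cons word_nil addr0 mulr_algl.
Qed.

Lemma coord_raise w t :
  coord (wd w) (replace y x t) = \sum_(u <- flips w) coord (wd u) t.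
Proof.
elim: w t => [|b w IHw] t.
  by rewrite big_nil coord_nil_derive // => i; rewrite coordZ coord_word mulr0.
rewrite [wd _]/= -coord_tail tail_replace coordP IHw /= big_cat big_map /=.
congr (_ + _); last by apply: eq_bigr => u _; rewrite coord_tail.
case: b => /=; first by rewrite (negPf xy) mul0r big_nil.
by rewrite eqxx mul1r big_seq1 /= coord_tail.
Qed.

Lemma coord_rot k w t :
  (forall i v, coord (rcons v i) t = coord (i :: v) t) ->
  coord (wd (rot k w)) t = coord (wd w) t.
Proof.
move=> t_rot; rewrite map_rot; move: (wd w) => {}w.
have [kw|/ltnW/rot_oversize -> //] := leqP k (size w).
elim: k kw => [|k IHk] kw; first by rewrite rot0.
rewrite rotS // -(IHk (ltnW kw)); case: (rot k w) => // i v.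
by rewrite rot1_cons.
Qed.

(** Every row of the system is an equation that [t] satisfies: a coordinate of its image under
    raising, a shuffle relation for one of its tails, or a prescribed zero. *)
Lemma symplectic_lie_determined m q (es : seq (seq bool))
    (shs : seq (bool * (seq bool * seq bool))) (pivots : seq (seq bool)) t :
  (forall v, coord v t != 0 -> size v == m) ->
  (forall v, coord v t != 0 -> count_mem y v == q) ->
  (forall i v, coord (rcons v i) t = coord (i :: v) t) ->
  replace y x t = 0 -> (forall i, primitive (tail i t)) ->
  all (fun c => (c.2.1 != [::]) && (c.2.2 != [::])) shs ->
  (forall p, p \in pivots -> coord (wd p) t = 0) ->
  determines m q ([seq flips e | e <- es] ++
    [seq map (cons c.1) (shuffle c.2.1 c.2.2) | c <- shs] ++ [seq [:: p] | p <- pivots]) ->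
  t = 0.
Proof.
move=> tm tq t_rot Et tl /allP shs_ne piv0 det; apply: binary_coord_ext => w.
rewrite [RHS]linear0; apply/eqP/negPn/negP => wt.
suff wt0 : coord (wd w) t = 0 by rewrite wt0 eqxx in wt.
apply: (determinesP (F := fun u => coord (wd u) t) det) => [k u|rel||].
- exact: coord_rot.
- rewrite !mem_cat => /or3P[] /mapP[].
  + by move=> e _ ->; rewrite -coord_raise Et linear0.
  + move=> [b [u v]] /shs_ne /andP[/= u0 v0] ->.
    rewrite big_map -[RHS](proj2 (tl (binary_letter b)) (wd u) (wd v)).
    - by rewrite /shuffle_coord map_shuffle big_map; apply: eq_bigr => c _; rewrite coord_tail.
    - by case: (u) u0.
    by case: (v) v0.
  + by move=> p p_piv ->; rewrite big_seq1 piv0.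
- by have /tm := wt; rewrite size_map => /eqP.
have /tq := wt; rewrite count_map => /eqP <-; apply: eq_count => b /=.
by rewrite /binary_letter; case: b; rewrite ?eqxx ?(negPf xy).
Qed.

End BinaryWords.

(* Noncommutative polynomials in two letters with integer coefficients:
   [Node c l r] stands for [c + x l + y r]. *)
Inductive trie := Empty | Node of Z & trie & trie.

(** The zero test keeps products sparse: in a homogeneous polynomial the nodes above the top degree
    carry the coefficient 0. *)
Definition trie_scale (c : Z) : trie -> trie :=
  if Z.eqb c 0 then fun=> Empty else
  fix scale t := if t is Node d l r then Node (Z.mul c d) (scale l) (scale r) else Empty.

Fixpoint trie_add (s t : trie) : trie :=
  match s, t with
  | Empty, _ => t
  | _, Empty => s
  | Node c l r, Node d l' r' => Node (Z.add c d) (trie_add l l') (trie_add r r')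
  end.

Definition trie_sub s t := trie_add s (trie_scale (-1) t).

Fixpoint trie_mul (s t : trie) : trie :=
  if s is Node c l r
  then trie_add (trie_scale c t) (Node 0 (trie_mul l t) (trie_mul r t)) else Empty.

Definition trie_one := Node 1 Empty Empty.
Definition trie_x := Node 0 trie_one Empty.
Definition trie_y := Node 0 Empty trie_one.

Definition trie_bracket s t := trie_sub (trie_mul s t) (trie_mul t s).

Definition trie_head t := if t is Node c _ _ then c else Z0.

Definition trie_tail (b : bool) t :=
  if t is Node _ l r then if b then r else l else Empty.

Fixpoint trie_coord (w : seq bool) t : Z :=
  if w is b :: w' then trie_coord w' (trie_tail b t) else trie_head t.

Fixpoint trie_is0 t :=
  if t is Node c l r then [&& Z.eqb c 0, trie_is0 l & trie_is0 r] else true.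

Fixpoint trie_homog m t :=
  if t is Node c l r then
    if m is m'.+1 then [&& Z.eqb c 0, trie_homog m' l & trie_homog m' r]
    else trie_is0 l && trie_is0 r
  else true.

(** The Dynkin operator, sending a word to its right-nested bracket. The terms with [trie_head] are
    the words of length one, sent to themselves. *)
Fixpoint trie_dynkin t :=
  if t is Node _ l r then
    trie_add
      (trie_add (trie_scale (trie_head l) trie_x) (trie_bracket trie_x (trie_dynkin l)))
      (trie_add (trie_scale (trie_head r) trie_y) (trie_bracket trie_y (trie_dynkin r)))
  else Empty.

Fixpoint trie_derive dx dy t :=
  if t is Node _ l r then
    trie_add (Node 0 (trie_derive dx dy l) (trie_derive dx dy r))
      (trie_add (trie_mul dx l) (trie_mul dy r))
  else Empty.

Definition trie_rotate t :=
  if t is Node c l r then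
    trie_add (Node c Empty Empty) (trie_add (trie_mul l trie_x) (trie_mul r trie_y))
  else Empty.

Fixpoint trie_cyclic m t :=
  if m is m'.+1 then trie_add t (trie_cyclic m' (trie_rotate t)) else Empty.

Definition trie_contract t :=
  trie_sub (trie_tail true (trie_tail false t)) (trie_tail false (trie_tail true t)).

(** * Correctness of the trie operations *)

Section Denotation.

Context {n : nat} {A : free_algebra n} (x y : 'I_n).
Context (xy : x != y) (xyP : forall i, (i == x) || (i == y)).

Local Notation wd := (map (binary_letter x y)).

Fixpoint den (t : trie) : A :=
  if t is Node c l r then (rat_of_Z c)%:A + letter x * den l + letter y * den r else 0.

Lemma den_scale c t : den (trie_scale c t) = rat_of_Z c *: den t.
Proof.
rewrite /trie_scale; case: Z.eqb_spec => [->|_]; first by rewrite scale0r.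
elim: t => [|d l IHl r IHr] /=; first by rewrite scaler0.
by rewrite IHl IHr rat_of_ZM !scalerDr scalerA !free_scalerAr.
Qed.

Lemma den_add s t : den (trie_add s t) = den s + den t.
Proof.
elim: s t => [|c l IHl r IHr] [|d l' r'] /=; rewrite ?add0r ?addr0 //.
by rewrite IHl IHr rat_of_ZD scalerDl !mulrDr [RHS]addrACA [X in _ = X + _]addrACA.
Qed.

Lemma den_sub s t : den (trie_sub s t) = den s - den t.
Proof. by rewrite den_add den_scale scaleN1r. Qed.

Lemma den_mul s t : den (trie_mul s t) = den s * den t.
Proof.
elim: s => [|c l IHl r IHr]; first by rewrite mul0r.
rewrite [trie_mul _ _]/= den_add den_scale /= scale0r add0r IHl IHr.
by rewrite !mulrDl mulr_algl !mulrA addrA.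
Qed.

Lemma den_x : den trie_x = letter x.
Proof. by rewrite /= !mulr0 !addr0 scale1r scale0r add0r mulr1. Qed.

Lemma den_y : den trie_y = letter y.
Proof. by rewrite /= !mulr0 !addr0 scale1r scale0r add0r mulr1. Qed.

Lemma den_bracket s t : den (trie_bracket s t) = den s * den t - den t * den s.
Proof. by rewrite den_sub !den_mul. Qed.

Lemma tail_den b t : tail (binary_letter x y b) (den t) = den (trie_tail b t).
Proof.
case: t => [|c l r] /=; first by rewrite linear0.
rewrite !linearD linearZ /= tail1 !tail_letter scaler0 add0r /binary_letter.
case: b; rewrite ?eqxx ?(negPf xy) 1?eq_sym ?(negPf xy) ?scale0r ?scale1r.
  by rewrite add0r.
by rewrite addr0.
Qed.

Lemma coord_den w t : coord (wd w) (den t) = rat_of_Z (trie_coord w t).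
Proof.
elim: w t => [|b w IHw] t /=; last by rewrite -coord_tail tail_den IHw.
case: t => [|c l r] /=; first by rewrite linear0.
by rewrite !coordD coordZ coord1 !coord_nil_letter !addr0 mulr1.
Qed.

Lemma trie_is0P t : trie_is0 t -> den t = 0.
Proof.
elim: t => //= c l IHl r IHr /and3P[/Z.eqb_spec -> /IHl -> /IHr ->].
by rewrite scale0r !mulr0 !addr0.
Qed.

Lemma trie_homogP m t : trie_homog m t -> forall w, coord w (den t) != 0 -> size w == m.
Proof.
move=> ht w; rewrite -(binary_wordP xyP w) coord_den size_map rat_of_Z_eq0.
move: [seq i == y | i <- w] => {}w.
have coord_Empty u : trie_coord u Empty = Z0 by elim: u.
elim: w m t ht => [|b w IHw] m [|c l r] //=; rewrite ?coord_Empty //.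
  by case: m => // m /and3P[->].
case: m => [/andP[l0 r0]|m /and3P[_ hl hr] wt].
  by rewrite -rat_of_Z_eq0 -coord_den; case: b; rewrite trie_is0P ?linear0 ?eqxx.
by rewrite eqSS; apply: IHw wt; case: (b).
Qed.

Lemma den_derive dx dy t : den (trie_derive dx dy t) =
  derive (fun i => if i == x then den dx else den dy) (den t).
Proof.
elim: t => [|c l IHl r IHr]; first by rewrite linear0.
rewrite -[trie_derive _ _ _]/(trie_add (Node 0 (trie_derive dx dy l) (trie_derive dx dy r))
  (trie_add (trie_mul dx l) (trie_mul dy r))) !den_add !den_mul /= IHl IHr.
rewrite scale0r add0r.
rewrite !linearD linearZ /= derive1 scaler0 add0r !derive_letterM eqxx.
by rewrite [y == x]eq_sym (negPf xy) addrC addrACA.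
Qed.

Lemma den_rotate t : den (trie_rotate t) = rotate_word (den t).
Proof.
case: t => [|c l r]; first by rewrite linear0.
rewrite !den_add !den_mul den_x den_y /= !mulr0 !addr0 !linearD linearZ /=.
by rewrite rotate1 !rotate_letterM addrA.
Qed.

Lemma den_cyclic m t : trie_homog m t -> den (trie_cyclic m t) = cyclic (den t).
Proof.
move=> /trie_homogP tm; rewrite (cyclic_rotate tm).
elim: (m) t {tm} => [|k IHk] t; first by rewrite big_ord0.
rewrite [trie_cyclic _ _]/= den_add IHk big_ord_recl; congr (_ + _).
by apply: eq_bigr => i _; rewrite den_rotate lift0 iterSr.
Qed.

Lemma sum_letters (V : nmodType) (F : 'I_n -> V) : \sum_i F i = F x + F y.
Proof.
rewrite (bigD1 x) //= (bigD1 y) /=; last by rewrite eq_sym.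
by rewrite big1 ?addr0 // => i /andP[/negPf ix /negPf iy]; have := xyP i; rewrite ix iy.
Qed.

Lemma den_contract (om : 'M[rat]_n) t : om x x = 0 -> om y y = 0 -> om x y = 1 ->
  om y x = -1 -> den (trie_contract t) = contract om (den t).
Proof.
move=> oxx oyy oxy oyx; rewrite contractE !sum_letters oxx oyy oxy oyx.
rewrite !scale0r add0r addr0 scale1r scaleN1r den_sub.
by rewrite -!(tail_den true) -!(tail_den false) -(tail_den true).
Qed.

Lemma dynkin_lie t : lie_element (den (trie_dynkin t)).
Proof.
have lie_scale (c : rat) (s : A) : lie_element s -> lie_element (c *: s).
  by move=> ls; rewrite -[_ *: _]addr0; apply: lie_lin => //; apply: lie_zero.
have lie_add (s s' : A) : lie_element s -> lie_element s' -> lie_element (s + s').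
  by move=> ls ls'; rewrite -[s]scale1r; apply: lie_lin.
have lie_letter i : lie_element (letter i : A) by apply: lie_gen; exists i.
elim: t => [|c l IHl r IHr]; first exact: lie_zero.
rewrite -[trie_dynkin _]/(trie_add
  (trie_add (trie_scale (trie_head l) trie_x) (trie_bracket trie_x (trie_dynkin l)))
  (trie_add (trie_scale (trie_head r) trie_y) (trie_bracket trie_y (trie_dynkin r)))).
rewrite den_add !(den_add (trie_scale _ _)) !den_scale !den_bracket den_x den_y.
apply: (lie_add); apply: (lie_add).
- exact/lie_scale/lie_letter.
- exact: lie_br (lie_letter x) IHl.
- exact/lie_scale/lie_letter.
- exact: lie_br (lie_letter y) IHr.
Qed.

(** Values of the Dynkin operator are Lie elements, and [m] is invertible in the rationals. *)
Lemma trie_lie (m : nat) t : (0 < m)%N ->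
  trie_is0 (trie_sub (trie_dynkin t) (trie_scale (Z.of_nat m) t)) -> lie_element (den t).
Proof.
move=> m0 /trie_is0P; rewrite den_sub den_scale rat_of_nat => /subr0_eq dE.
have -> : den t = m%:R^-1 *: den (trie_dynkin t) + 0.
  by rewrite addr0 dE scalerA mulVf ?scale1r // pnatr_eq0 -lt0n.
by apply: lie_lin; [apply: dynkin_lie | apply: lie_zero].
Qed.

End Denotation.

(** * The trace cocycle on symplectic derivations *)

Section TraceCocycle.

Context {n : nat} {A : free_algebra n} (om : 'M[rat]_n).
Context (om_anti : forall i j, om j i = - om i j)
  (om_sq : forall i k, \sum_j om i j * om j k = - (i == k)%:R).
Implicit Types (s t : A) (i j : 'I_n).

Definition derivation t i : A := \sum_j om i j *: tail j t.

Definition bracket s t : A := \sum_i \sum_j om i j *: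
  (letter j * (derive (derivation s) (derivation t i) - derive (derivation t) (derivation s i))).

Lemma divergenceE s : \sum_j tail j (derivation s j) = - contract om s.
Proof.
rewrite contractE exchange_big /= -sumrN; apply: eq_bigr => j _.
rewrite linear_sum -sumrN; apply: eq_bigr => i _ /=.
by rewrite linearZ /= om_anti scaleNr.
Qed.

Lemma coord_nil_derivation s i : (forall j, coord [:: j] s = 0) ->
  coord [::] (derivation s i) = 0.
Proof.
by move=> s1; rewrite linear_sum big1 // => j _; rewrite linearZ /= coord_tail s1 scaler0.
Qed.

Lemma tail_bracket s t l : tail l (bracket s t) = \sum_i om i l *:
  (derive (derivation s) (derivation t i) - derive (derivation t) (derivation s i)).
Proof.
rewrite linear_sum; apply: eq_bigr => i _; rewrite linear_sum (bigD1 l) //=.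
rewrite linearZ /= tail_letter eqxx scale1r big1 ?addr0 // => j jl.
by rewrite linearZ /= tail_letter (negPf jl) scale0r scaler0.
Qed.

(** One factor [om] comes from encoding the commutator as a tensor and one from the contraction; by
    [om_sq] they compose to minus the identity. *)
Lemma contract_bracket s t : contract om (bracket s t) = - \sum_i tail i
  (derive (derivation s) (derivation t i) - derive (derivation t) (derivation s i)).
Proof.
set B := fun i => derive (derivation s) (derivation t i) - derive (derivation t) (derivation s i).
rewrite contractE -sumrN exchange_big; apply: eq_bigr => m _ /=.
transitivity (\sum_i (\sum_l om i l * om l m) *: tail m (B i)).
  under eq_bigr => l _ do rewrite tail_bracket linear_sum scaler_sumr.
  rewrite exchange_big; apply: eq_bigr => i _; rewrite scaler_suml.
  by apply: eq_bigr => l _; rewrite linearZ /= scalerA mulrC.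
rewrite (bigD1 m) //= om_sq eqxx scaleN1r big1 ?addr0 // => i im.
by rewrite om_sq (negPf im) oppr0 scale0r.
Qed.

Lemma cyclic_contract_bracket s t :
  (forall j, coord [:: j] s = 0) -> (forall j, coord [:: j] t = 0) ->
  cyclic (contract om (bracket s t)) =
  cyclic (derive (derivation s) (contract om t)) -
  cyclic (derive (derivation t) (contract om s)).
Proof.
move=> s1 t1; rewrite contract_bracket linearN /= cyclic_divergence; last first.
- by move=> k; apply: coord_nil_derivation.
- by move=> k; apply: coord_nil_derivation.
by rewrite !divergenceE !(linearN (derive _)) !(linearN cyclic) opprB opprK addrC.
Qed.

Lemma bracket_linl a s s' t : bracket (a *: s + s') t = a *: bracket s t + bracket s' t.
Proof.
have derivL i : derivation (a *: s + s') i = a *: derivation s i + derivation s' i.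
  rewrite /derivation scaler_sumr -big_split; apply: eq_bigr => j _ /=.
  by rewrite linearP scalerDr !scalerA mulrC.
have deriveL u : derive (derivation (a *: s + s')) u =
    a *: derive (derivation s) u + derive (derivation s') u.
  move: u; apply: tensor_ext => [||w]; first exact: derive_lin.
    by apply: add_lin; [apply: scale_lin|]; apply: derive_lin.
  elim: w => [|i w IHw]; first by rewrite word_nil !derive1 scaler0 addr0.
  rewrite word_cons !derive_letterM derivL IHw mulrDl mulrDr -scalerAl free_scalerAr.
  by rewrite addrACA scalerDr.
rewrite /bracket scaler_sumr -big_split; apply: eq_bigr => i _ /=.
rewrite scaler_sumr -big_split; apply: eq_bigr => j _ /=.
rewrite deriveL derivL linearP opprD addrACA -scalerBr mulrDr free_scalerAr.
by rewrite scalerDr !scalerA mulrC.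
Qed.

Lemma bracket_anti s t : bracket s t = - bracket t s.
Proof.
rewrite /bracket -sumrN; apply: eq_bigr => i _; rewrite -sumrN; apply: eq_bigr => j _.
by rewrite -scalerN -mulrN opprB.
Qed.

Definition even_supp t : Prop := forall w, coord w t != 0 -> ~~ odd (size w).

(* Even length replaces the low-degree conventions: there the contraction followed
   by the cyclic sum vanishes automatically in length at most two. *)
Definition traceless t : Prop := even_supp t /\ cyclic (contract om t) = 0.

Lemma even_supp_lin a s t : even_supp s -> even_supp t -> even_supp (a *: s + t).
Proof.
move=> es et w; apply: contraR; rewrite negbK coordP => ow.
have [/eqP -> | /es] := boolP (coord w s == 0); last by rewrite ow.
have [/eqP -> | /et] := boolP (coord w t == 0); last by rewrite ow.
by rewrite mulr0 addr0.
Qed.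

(** An evenly supported tensor sends letters to words of odd length, so its derivation preserves the
    parity of lengths; the bracket prefixes one letter to an odd result. *)
Lemma bracket_even s t : even_supp s -> even_supp t -> even_supp (bracket s t).
Proof.
move=> es et.
have derivO u i : even_supp u -> forall w, coord w (derivation u i) != 0 -> odd (size w).
  move=> eu w; apply: contraR => ow; rewrite linear_sum big1 // => j _.
  rewrite linearZ /= coord_tail; have [/eqP ->|/eu] := boolP (coord (j :: w) u == 0).
    by rewrite scaler0.
  by rewrite /= ow.
have deriveO u v : even_supp u -> (forall w, coord w v != 0 -> odd (size w)) ->
    forall w, coord w (derive (derivation u) v) != 0 -> odd (size w).
  move=> eu ov; apply: supp_extend ov => w ow.
  have: forall w', coord w' (derive_word (derivation u) w) != 0 -> odd (size w' + size w).+1.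
    elim: w {ow} => [|i w IHw] w'; first by rewrite linear0 eqxx.
    rewrite [derive_word _ _]/= coordD => /eqP/eqP; apply: contraR => ow'.
    suff [-> ->] : coord w' (derivation u i * word w) = 0 /\
        coord w' (letter i * derive_word (derivation u) w) = 0 by rewrite addr0.
    split; apply/eqP; apply: contraNT ow'.
      apply: (supp_mul (P := fun w => odd (size w)) (Q := pred1 w)
        (R := fun w' => odd (size w' + (size w).+1).+1)) => [v1 v2|v1|v1].
      - by move=> /= o1 /eqP ->; rewrite size_cat addnS -addnA addnn /= negbK oddD odd_double addbF.
      - by apply: derivO.
      by rewrite coord_word pnatr_eq0 eqb0 negbK eq_sym.
    apply: (supp_mul (P := pred1 [:: i]) (Q := fun v => odd (size v + size w).+1)
      (R := fun w' => odd (size w' + (size w).+1).+1)) => [v1 v2|v1|v1].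
    - by move=> /= /eqP ->; rewrite cat1s [size _]/= addSn addnS /= negbK.
    - by rewrite coord_word pnatr_eq0 eqb0 negbK eq_sym.
    exact: IHw.
  by move=> H w' /H; rewrite /= oddD ow; case: odd.
move=> [|l w] //; rewrite -coord_tail tail_bracket => wN0 /=; rewrite negbK.
apply: contraNT wN0 => ow; rewrite linear_sum big1 // => i _; rewrite linearZ /= linearB /=.
have zero v : (forall w, coord w v != 0 -> odd (size w)) -> coord w v = 0.
  by move=> ov; apply/eqP; apply: contraR ow; apply: ov.
rewrite [X in X - _]zero ?[X in _ - X]zero ?addr0 ?oppr0 ?scaler0 //;
  by apply: deriveO => // w'; apply: derivO.
Qed.

(** By [cyclic_derive] the cyclic sum of a derived tensor depends only on the cyclic sum of the
    tensor, so both terms of the cocycle formula vanish. *)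
Lemma bracket_traceless s t : traceless s -> traceless t -> traceless (bracket s t).
Proof.
move=> [es s0] [et t0]; split; first exact: bracket_even.
have even1 u : even_supp u -> forall j, coord [:: j] u = 0.
  by move=> eu j; apply/eqP/negPn/negP => /eu.
rewrite cyclic_contract_bracket; try exact: even1.
by rewrite ![cyclic (derive _ _)]cyclic_derive s0 t0 !linear0 addr0.
Qed.

End TraceCocycle.

(** * Infinitesimal invariance and cyclic words with one letter y *)

Section HighestWeightTrace.

Context {n : nat} {A : free_algebra n} (x y : 'I_n).
Context (xy : x != y) (xyP : forall i, (i == x) || (i == y)).
Implicit Types (s t v : A).

Local Notation wd := (map (binary_letter x y)).
Local Notation E := (@replace n A y x).

Lemma shear_fixed_replace p q m t : p != q ->
  (forall w, coord w t != 0 -> size w == m) ->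
  (forall a, act (shear p q a) t = t) -> replace p q t = 0.
Proof.
move=> pq tm fixt; case: m tm => [|m] tm.
  exact: (iter_replace_size (k := 1) pq _ tm).
(* The term of index 0 in the expansion cancels against [t], hence the value 0 there. *)
pose v k := if k is 0 then 0 else k`!%:R^-1 *: iter k (replace p q) t.
suff: v 1%N = 0 by rewrite /v factS fact0 invr1 scale1r.
apply: (subspace_moments (P := fun s => s = 0) (m := m.+2) (c := fun k => 2 ^+ k)) => //.
- by split=> // a s s' -> ->; rewrite scaler0 addr0.
- by move=> i j _ _; apply: (@ieexprIn rat 2).
move=> i; have := fixt (2 ^+ i); rewrite (act_shear _ pq tm) big_ord_recl /= expr0 scale1r.
rewrite fact0 invr1 scale1r => /eqP; rewrite -subr_eq0 addrAC subrr add0r => /eqP.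
move=> sum0; rewrite big_ord_recl [v _]/= scaler0 add0r -[RHS]sum0; apply: eq_bigr => k _.
by rewrite exprAC.
Qed.

Lemma replace_fixed_shear p q m a t : p != q ->
  (forall w, coord w t != 0 -> size w == m) ->
  replace p q t = 0 -> act (shear p q a) t = t.
Proof.
move=> pq tm Et; rewrite (act_shear _ pq tm) big_ord_recl expr0 fact0 invr1 !scale1r.
rewrite big1 ?addr0 // => k _; rewrite lift0 iterSr Et.
by rewrite (_ : iter _ _ 0 = 0) ?scaler0 //; elim: (nat_of_ord k) => //= l ->; rewrite linear0.
Qed.

Lemma coord_weight_op (w : seq 'I_n) t : coord w (weight_op x y t) = weight x y w * coord w t.
Proof.
move: t; apply: (@tensor_ext _ _ rat^o) => [||u].
- exact: comp_lin (coord_linear _) (weight_op_lin _ _).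
- exact: scale_lin (coord_linear w).
by rewrite weight_op_word // coordZ coord_word; case: eqP => [->|]; rewrite ?mulr0.
Qed.

Lemma coord_rotate k (w : seq 'I_n) t : rotate_word t = t -> coord (rot k w) t = coord w t.
Proof.
have rot1 u : coord (rot 1 u) (rotate_word t) = coord u t.
  move: t; apply: (@tensor_ext _ _ rat^o) => [||v].
  - exact: comp_lin (coord_linear _) rotate_lin.
  - exact: coord_linear.
  by rewrite /rotate_word extend_word !coord_word (inj_eq (@rot_inj _ _)).
move=> tr; have [kw|/ltnW/rot_oversize -> //] := leqP k (size w).
elim: k kw => [|k IHk] kw; first by rewrite rot0.
by rewrite rotS // -{1}tr rot1 IHk // ltnW.
Qed.

Lemma rotate_cyclic t : rotate_word (cyclic t) = cyclic t.
Proof.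
move: t; apply: tensor_ext => [||w].
- exact: comp_lin rotate_lin cyclic_lin.
- exact: cyclic_lin.
rewrite -[RHS]cyclic_word_rot1 !cyclic_word size_rot linear_sum; apply: eq_bigr => p _.
by rewrite /= /rotate_word extend_word rot_rot.
Qed.

(** As [om] vanishes on equal letters, every contracted pair consists of one [x] and one [y]. *)
Lemma contract_supp (om : 'M[rat]_n) N q t : om x x = 0 -> om y y = 0 ->
  (forall w, coord w t != 0 -> (size w == N.+2) && (count_mem y w == q.+1)) ->
  forall w, coord w (contract om t) != 0 -> (size w == N) && (count_mem y w == q).
Proof.
move=> oxx oyy; have yx : (y == x) = false by rewrite eq_sym; apply: negPf.
apply: supp_extend => -[|i [|j u]] //= /andP[uN uq] w.
rewrite coordZ mulf_eq0 negb_or coord_word pnatr_eq0 eqb0 negbK => /andP[oij /eqP <-].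
rewrite -[size u == N]/((size u).+2 == N.+2) uN /=; move: oij uq.
case/orP: (xyP i) => /eqP ->; case/orP: (xyP j) => /eqP ->; rewrite ?oxx ?oyy ?eqxx //.
  by rewrite (negPf xy) add0n add1n.
by rewrite (negPf xy) add0n add1n.
Qed.

Lemma contract_size (om : 'M[rat]_n) N t : (forall w, coord w t != 0 -> size w == N.+2) ->
  forall w, coord w (contract om t) != 0 -> size w == N.
Proof.
apply: supp_extend => -[|i [|j u]] //= uN w; rewrite coordZ mulf_eq0 negb_or.
by rewrite coord_word pnatr_eq0 eqb0 negbK => /andP[_ /eqP <-].
Qed.

Lemma cyclic_supp (P : pred (seq 'I_n)) t : (forall k w, P (rot k w) = P w) ->
  (forall w, coord w t != 0 -> P w) -> forall w, coord w (cyclic t) != 0 -> P w.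
Proof.
move=> Prot; apply: supp_extend => u Pu w; apply: contraR => nPw; apply/eqP.
rewrite linear_sum big1 // => p _; rewrite /= coord_word; case: eqP => // uw.
by rewrite -uw Prot Pu in nPw.
Qed.

Lemma flips_nseq N : size (flips (nseq N false)) = N /\
  forall u, u \in flips (nseq N false) -> size u = N /\ count id u = 1%N.
Proof.
elim: N => [|N [IHs IHc]] //=; rewrite size_map IHs; split=> // u.
rewrite inE => /orP[/eqP ->|/mapP[u' /IHc[su cu] ->]] /=; last by rewrite su cu.
by rewrite size_nseq count_nseq.
Qed.

Lemma rot_count1 (u : seq bool) : count id u = 1%N ->
  exists k, rot k u = true :: nseq (size u).-1 false.
Proof.
move=> u1; have: true \in u by rewrite -has_pred1 has_count (eq_count (a2 := id)) ?u1 // => -[].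
case/rot_to => k s kE; exists k; rewrite kE; congr (_ :: _).
have sE : (size u).-1 = size s by rewrite -(size_rot k) kE.
have: count id (rot k u) = 1%N by rewrite -u1; apply/permP; rewrite perm_rot.
rewrite kE /= add1n sE => -[s0]; apply/all_pred1P; rewrite all_count -(count_predC id s) s0 add0n.
by apply/eqP/eq_count => -[].
Qed.

(* Cyclic words with a single letter [y] form a line, on which raising is injective. *)
Lemma cyclic_one_letter N t : (0 < N)%N ->
  (forall w, coord w t != 0 -> (size w == N) && (count_mem y w == 1%N)) ->
  rotate_word t = t -> E t = 0 -> t = 0.
Proof.
move=> N0 tN tr Et; apply: (binary_coord_ext xyP) => w; rewrite [RHS]linear0.
pose b := true :: nseq N.-1 false.
have coordE u : size u = N -> count id u = 1%N -> coord (wd u) t = coord (wd b) t.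
  move=> uN /rot_count1[k kE]; rewrite -(coord_rotate k) // -map_rot kE uN.
  by [].
(* The coordinate of [E t] at x^N is a sum of N coordinates of [t], all equal by rotation. *)
have b0 : coord (wd b) t = 0.
  have := coord_raise xy (nseq N false) t; rewrite Et linear0.
  have [sN uN] := flips_nseq N; rewrite big_seq (eq_bigr (fun=> coord (wd b) t)); last first.
    by move=> u /uN[? ?]; apply: coordE.
  rewrite -big_seq big_const_seq count_predT sN iter_addr_0 => /esym/eqP.
  by rewrite mulrn_eq0 eqn0Ngt N0 => /eqP.
apply/eqP/negPn/negP => wN0; have /andP[wN w1] := tN _ wN0.
case/eqP: wN0; apply: (etrans (coordE w _ _) b0); first by rewrite size_map in wN; apply/eqP.
move: w1; rewrite count_map => /eqP <-; apply: eq_count => -[] /=.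
  by rewrite eqxx.
by rewrite (negPf xy).
Qed.

End HighestWeightTrace.

(** * Sp(2) as SL(2), generated by shears *)

Section SpecialLinear.

Context {n : nat} {A : free_algebra n} (x y : 'I_n).
Context (xy : x != y) (xyP : forall i, (i == x) || (i == y)).
Implicit Types (s t v : A) (M N : 'M[rat]_n).

Let yx : (y == x) = false.
Proof. by rewrite eq_sym; apply: negPf. Qed.

(** The determinant read off on the two letters, as [n] is known to be two only through [xyP]. *)
Definition letter_det M : rat := M x x * M y y - M x y * M y x.

Lemma eq_letter_mx M N : M x x = N x x -> M x y = N x y -> M y x = N y x ->
  M y y = N y y -> M = N.
Proof.
move=> eqxx_ eqxy eqyx eqyy; apply/matrixP => i j.
by case/orP: (xyP i) => /eqP ->; case/orP: (xyP j) => /eqP ->.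
Qed.

Definition letter_mxE := (mxE, sum_letters xy xyP, eqxx, negPf xy, yx, andbT, andbF,
  mulr1n, mulr0n, mulr0, mulr1, mul0r, mul1r, add0r, addr0).

Lemma shear_det p q a : p != q -> letter_det (shear p q a) = 1.
Proof.
rewrite /letter_det /shear.
case/orP: (xyP p) => /eqP ->; case/orP: (xyP q) => /eqP ->; rewrite ?eqxx //= => _;
  by rewrite !letter_mxE /= ?letter_mxE; ring.
Qed.

Lemma letter_symplectic (om : 'M[rat]_n) M : om x x = 0 -> om y y = 0 ->
  om x y = 1 -> om y x = -1 -> (M^T *m om *m M == om) = (letter_det M == 1).
Proof.
move=> oxx oyy oxy oyx; apply/eqP/eqP => [/matrixP/(_ x y)|detM].
  rewrite !letter_mxE oxx oyy oxy oyx !letter_mxE /letter_det => <-.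
  by rewrite mulrN1 mulNr; ring.
apply: eq_letter_mx; rewrite !letter_mxE oxx oyy oxy oyx !letter_mxE.
- ring.
- by rewrite -[RHS]detM /letter_det; ring.
- by rewrite -[X in _ = - X]detM /letter_det; ring.
- ring.
Qed.

(** With a nonzero lower left entry the diagonal of [M] prescribes the outer factors, and
    determinant 1 then yields the upper right entry. *)
Lemma shear_factorization M : letter_det M = 1 -> M y x != 0 ->
  M = shear y x ((M x x - 1) / M y x) *m shear x y (M y x) *m
      shear y x ((M y y - 1) / M y x).
Proof.
move=> detM c0; have bE : M x y = (M x x * M y y - 1) / M y x.
  by rewrite -detM /letter_det opprB addrC subrK mulfK.
by apply: eq_letter_mx; rewrite !letter_mxE /= ?letter_mxE ?bE; field.
Qed.

Lemma shear_stable_special (W : A -> Prop) : shear_stable x y W ->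
  forall M t, letter_det M = 1 -> W t -> W (act M t).
Proof.
move=> stW; have lowW M t : letter_det M = 1 -> M y x != 0 -> W t -> W (act M t).
  move=> detM c0 Wt; rewrite (shear_factorization detM c0) !act_mulmx.
  have [_ W1] := stW ((M y y - 1) / M y x) _ Wt; have [W2 _] := stW (M y x) _ W1.
  by have [_] := stW ((M x x - 1) / M y x) _ W2.
move=> M t detM Wt; have [c0|] := eqVneq (M y x) 0; last by move=> c0; apply: lowW.
(* This shear adds [M y y], nonzero when [M y x] is zero, to the lower left entry. *)
have -> : M = (M *m shear x y 1) *m shear x y (-1).
  by apply: eq_letter_mx; rewrite !letter_mxE /= ?letter_mxE; ring.
rewrite act_mulmx; apply: lowW; last by case: (stW (-1) _ Wt).
  by rewrite -detM /letter_det !letter_mxE /= ?letter_mxE; ring.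
rewrite !letter_mxE /= ?letter_mxE c0 add0r; apply/eqP => d0.
by move/eqP: detM; rewrite /letter_det c0 d0 !mulr0 subr0 eq_sym oner_eq0.
Qed.

Lemma coord_act_diag M w t : M x y = 0 -> M y x = 0 -> M y y = (M x x)^-1 ->
  coord w (act M t) = M x x ^+ count_mem x w / M x x ^+ count_mem y w * coord w t.
Proof.
move=> b0 c0 dE; move: t; apply: (@tensor_ext _ _ rat^o) => [||u].
- exact: comp_lin (coord_linear _) (act_lin _).
- exact: scale_lin (coord_linear w).
have -> : act M (word u) = (M x x ^+ count_mem x u / M x x ^+ count_mem y u) *: word u :> A.
  elim: u => [|i u IHu]; first by rewrite word_nil act1 divr1 scale1r.
  rewrite word_cons act_letterM IHu (sum_letters xy xyP) free_scalerAr.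
  case/orP: (xyP i) => /eqP ->; rewrite ?b0 ?c0 ?dE scale0r ?addr0 ?add0r -scalerAl scalerA;
    congr (_ *: _); rewrite /= eqxx ?(negPf xy) ?yx /= ?add0n ?add1n exprS ?invfM; ring.
by rewrite coordZ coord_word; case: eqP => [->|]; rewrite ?mulr0.
Qed.

End SpecialLinear.

(** * Rotation-invariant tensors with primitive or Lie tails *)

Section LieCyclic.

Context {n : nat} {A : free_algebra n} (x y : 'I_n).
Context (xy : x != y) (xyP : forall i, (i == x) || (i == y)).
Implicit Types (s t v : A).

(* Highest weight vectors of length [m] with [q] letters [y] among the symplectic
   derivations; being a Lie element is weakened to primitivity. *)
Definition lie_cyclic (m q : nat) t : Prop :=
  [/\ forall w, coord w t != 0 -> size w == m,
      forall w, coord w t != 0 -> count_mem y w == q,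
      forall i w, coord (rcons w i) t = coord (i :: w) t,
      replace y x t = 0
    & forall i, primitive (tail i t)].

Lemma supp_lin (P : pred (seq 'I_n)) a s t : (forall w, coord w s != 0 -> P w) ->
  (forall w, coord w t != 0 -> P w) -> forall w, coord w (a *: s + t) != 0 -> P w.
Proof.
move=> Ps Pt w; apply: contraR => nPw; rewrite coordP.
have [/eqP -> | /Ps] := boolP (coord w s == 0); last by rewrite (negPf nPw).
have [/eqP -> | /Pt] := boolP (coord w t == 0); last by rewrite (negPf nPw).
by rewrite mulr0 addr0.
Qed.

Lemma lie_cyclic_lin m q a s t :
  lie_cyclic m q s -> lie_cyclic m q t -> lie_cyclic m q (a *: s + t).
Proof.
move=> [sm sq srot sE sp] [tm tq trot tE tp]; split.
- exact: supp_lin.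
- exact: supp_lin.
- by move=> i w; rewrite !coordP srot trot.
- by rewrite linearP /= sE tE scaler0 addr0.
move=> i; rewrite linearP; have [s0 sS] := sp i; have [t0 tS] := tp i.
split=> [|u v u0 v0]; first by rewrite coordP s0 t0 mulr0 addr0.
by rewrite shuffle_coordP sS // tS // mulr0 addr0.
Qed.

Fixpoint trie_count (q : nat) (r : trie) : bool :=
  if r is Node c r0 r1 then
    [&& (q == 0%N) || Z.eqb c Z0, trie_count q r0 &
        if q is q'.+1 then trie_count q' r1 else trie_is0 r1]
  else true.

(* [trie_dynkin r = m r] for [r] of length [m] is the Dynkin-Specht-Wever criterion. *)
Definition trie_symplectic_lie (m : nat) (r : trie) : bool :=
  [&& trie_homog m.+1 r, trie_is0 (trie_sub r (trie_rotate r)) &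
      all (fun b => trie_is0 (trie_sub (trie_dynkin (trie_tail b r))
             (trie_scale (Z.of_nat m) (trie_tail b r)))) [:: true; false]].

Lemma trie_countP q r : trie_count q r ->
  forall w, coord w (den x y r : A) != 0 -> count_mem y w == q.
Proof.
have coord_Empty u : trie_coord u Empty = Z0 by elim: u.
move=> rq w; rewrite -(binary_wordP xyP w) coord_den // rat_of_Z_eq0.
move: [seq i == y | i <- w] => {}w; have -> : count_mem y (map (binary_letter x y) w) = count id w.
  rewrite count_map; apply: eq_count => -[] /=; first by rewrite eqxx.
  by rewrite (negPf xy).
elim: w q r rq => [|b w IHw] q [|c r0 r1] //=; rewrite ?coord_Empty //.
  by rewrite eq_sym => /and3P[/orP[->|->]].
case: b => /and3P[_ q0 q1] /=; last exact: IHw.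
case: q q0 q1 => [|q] _ q1; last by move=> /(IHw _ _ q1); rewrite add1n eqSS.
by rewrite -rat_of_Z_eq0 -(coord_den (A := A) xy) trie_is0P // linear0 eqxx.
Qed.

Lemma den_raise r : replace y x (den x y r : A) = den x y (trie_derive Empty trie_x r).
Proof.
have yx : (y == x) = false by rewrite eq_sym; apply: negPf.
rewrite den_derive // den_x; apply: eq_derive => i.
by case/orP: (xyP i) => /eqP ->; rewrite ?eqxx ?yx ?(negPf xy) ?scale0r ?scale1r.
Qed.

Lemma den_lower r : replace x y (den x y r : A) = den x y (trie_derive trie_y Empty r).
Proof.
have yx : (y == x) = false by rewrite eq_sym; apply: negPf.
rewrite den_derive // den_y; apply: eq_derive => i.
by case/orP: (xyP i) => /eqP ->; rewrite ?eqxx ?yx ?(negPf xy) ?scale0r ?scale1r.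
Qed.

Lemma trie_symplectic_lieP m r : (0 < m)%N -> trie_symplectic_lie m r ->
  [/\ forall w, coord w (den x y r : A) != 0 -> size w == m.+1,
      rotate_word (den x y r) = den x y r :> A
    & forall i, lie_element (tail i (den x y r : A))].
Proof.
move=> m0 /and3P[rm rr /and3P[r1 r0 _]]; split.
- exact: trie_homogP.
- by apply/esym/eqP; rewrite -den_rotate -subr_eq0 -den_sub trie_is0P.
move=> i; rewrite -(binary_letterP xyP i) tail_den //.
by case: (i == y); [exact: trie_lie m0 r1 | exact: trie_lie m0 r0].
Qed.

Lemma trie_lie_cyclic m q r : (0 < m)%N -> trie_symplectic_lie m r -> trie_count q r ->
  trie_is0 (trie_derive Empty trie_x r) -> lie_cyclic m.+1 q (den x y r).
Proof.
move=> m0 /(trie_symplectic_lieP m0)[rm rr rl] rq rE; split=> //.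
- exact: trie_countP.
- by move=> i w; rewrite -rot1_cons coord_rotate.
- by rewrite den_raise trie_is0P.
by move=> i; apply: lie_primitive.
Qed.

Lemma rotate_tails t : coord [::] t = 0 -> rotate_word t = \sum_i tail i t * letter i.
Proof.
move=> t0; rewrite {1}(tensor_eta t) t0 scale0r add0r linear_sum.
by apply: eq_bigr => i _; rewrite [LHS]rotate_letterM.
Qed.

Lemma symplectic_lie_determined_by m q (es : seq (seq bool))
    (shs : seq (bool * (seq bool * seq bool))) (pivots : seq (seq bool)) t :
  lie_cyclic m q t ->
  all (fun c => (c.2.1 != [::]) && (c.2.2 != [::])) shs ->
  (forall p, p \in pivots -> coord (map (binary_letter x y) p) t = 0) ->
  determines m q ([seq flips e | e <- es] ++
    [seq map (cons c.1) (shuffle c.2.1 c.2.2) | c <- shs] ++ [seq [:: p] | p <- pivots]) ->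
  t = 0.
Proof. by move=> [tm tq trot tE tp]; apply: symplectic_lie_determined. Qed.

End LieCyclic.

(** * Encoding of the explicit tensors and of the checks on them *)

Fixpoint bits (s : string) : seq bool :=
  if s is String c s' then Ascii.eqb c "y" :: bits s' else [::].

Definition trie_of_bits (w : seq bool) : trie :=
  foldr (fun b r => if b then Node 0 Empty r else Node 0 r Empty) trie_one w.

Definition trie_sum (s : seq (Z * trie)) : trie :=
  foldr (fun p r => trie_add (trie_scale p.1 p.2) r) Empty s.

(* The tensor of a noncrossing matching, written as a balanced word: each matched
   pair of positions carries the symplectic tensor [x y - y x].  These tensors span
   the SL_2-invariants. *)
Fixpoint matching_rec (stack : seq trie) (s : string) : seq trie :=
  match s, stack with
  | String "("%char s', _ => matching_rec (trie_one :: stack) s'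
  | String _ s', a :: b :: stack' =>
      let arc := trie_sub (Node 0 (trie_mul a trie_y) Empty)
                          (Node 0 Empty (trie_mul a trie_x)) in
      matching_rec (trie_mul b arc :: stack') s'
  | _, _ => stack
  end.

Definition matching (s : string) : trie := head Empty (matching_rec [:: trie_one] s).

(** A derivation of degree 10 has a tensor of length 12 fixed by rotation, so candidates are built
    as sums over 12 rotations; being Lie is checked separately. *)
Definition matching_sum (s : seq (Z * string)) : trie :=
  trie_cyclic 12 (trie_sum [seq (p.1, matching p.2) | p <- s]).

(* Raising kills the tensor, its tails are orthogonal to proper shuffles, and its
   coordinates at the pivots are zero. *)
Definition relations (es : seq (seq bool)) (shs : seq (bool * (seq bool * seq bool)))
    (pivots : seq (seq bool)) : seq (seq (seq bool)) :=
  [seq flips e | e <- es] ++ [seq map (cons c.1) (shuffle c.2.1 c.2.2) | c <- shs] ++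
  [seq [:: p] | p <- pivots].

Definition proper_shuffles (shs : seq (bool * (seq bool * seq bool))) : bool :=
  all (fun c => (c.2.1 != [::]) && (c.2.2 != [::])) shs.

Definition trie_invariant (r : trie) : bool :=
  [&& trie_symplectic_lie 11 r, trie_is0 (trie_derive Empty trie_x r) &
      trie_is0 (trie_derive trie_y Empty r)].

(* The derivation [e], which sends [x] to its [y]-tail and [y] to minus its [x]-tail,
   applied to the contraction of [r]. *)
Definition trie_action (e r : trie) : trie :=
  trie_derive (trie_tail true e) (trie_scale (-1) (trie_tail false e)) (trie_contract r).

(* The finite computations on which the theorem rests, kept behind a record so that
   the explicit tensors are never unfolded outside their verification. *)
Record certificate := Certificate {
  eps4 : trie;
  eps4_lie : trie_symplectic_lie 5 eps4;
  eps4_count : trie_count 2 eps4;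
  eps4_raise : trie_is0 (trie_derive Empty trie_x eps4);
  eps4_contract : trie_homog 4 (trie_contract eps4);
  eps4_cyclic : trie_is0 (trie_cyclic 4 (trie_contract eps4));
  eps4_pivot : seq bool;
  eps4_pivot_neq0 : ~~ Z.eqb (trie_coord eps4_pivot eps4) Z0;
  eps4_shuffles : seq (bool * (seq bool * seq bool));
  eps4_proper : proper_shuffles eps4_shuffles;
  eps4_determined :
    determines 6 2 (relations (necklaces 6 1) eps4_shuffles [:: eps4_pivot]);
  inv : nat -> trie;
  inv_invariant : forall i, (i < 3)%N -> trie_invariant (inv i);
  pivot : nat -> seq bool;
  pivot_eq0 : forall i j, (i < j < 3)%N -> trie_coord (pivot i) (inv j) = Z0;
  pivot_neq0 : forall i, (i < 3)%N -> ~~ Z.eqb (trie_coord (pivot i) (inv i)) Z0;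
  inv_shuffles : seq (bool * (seq bool * seq bool));
  inv_proper : proper_shuffles inv_shuffles;
  inv_determined :
    determines 12 6 (relations (necklaces 12 5) inv_shuffles (map pivot (iota 0 3)));
  action_homog : forall i, (i < 3)%N -> trie_homog 14 (trie_action eps4 (inv i));
  action_eq0 : trie_is0 (trie_cyclic 14 (trie_action eps4 (inv 0)));
  probe : nat -> seq bool;
  probe_eq0 : trie_coord (probe 1) (trie_cyclic 14 (trie_action eps4 (inv 2))) = Z0;
  probe_neq0 : forall i, (0 < i < 3)%N ->
    ~~ Z.eqb (trie_coord (probe i) (trie_cyclic 14 (trie_action eps4 (inv i)))) Z0
}.

(** * Symplectic derivations in two letters, their traces and invariants *)

Section SymplecticDerivations.

Context {n : nat} {A : free_algebra n} (x y : 'I_n).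
Context (xy : x != y) (xyP : forall i, (i == x) || (i == y)).
Context (om : 'M[rat]_n) (oxx : om x x = 0) (oyy : om y y = 0)
  (oxy : om x y = 1) (oyx : om y x = -1).
Implicit Types (s t v : A) (M : 'M[rat]_n).

Local Notation E := (@replace n A y x).
Local Notation symplectic M := (M^T *m om *m M = om).

Definition symplectic_derivation (k : nat) t : Prop := exists f : 'I_n -> A,
  [/\ forall i, (forall w, coord w (f i) != 0 -> size w == k.+1) /\ lie_element (f i),
      t = \sum_i letter i * f i
    & \sum_i (letter i * f i - f i * letter i) = 0].

Definition invariant_derivation (k : nat) t : Prop :=
  symplectic_derivation k t /\ forall M, symplectic M -> act M t = t.

Lemma symplectic_derivationP k t : symplectic_derivation k t ->
  [/\ forall w, coord w t != 0 -> size w == k.+2,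
      forall i w, coord (rcons w i) t = coord (i :: w) t
    & forall i, primitive (tail i t)].
Proof.
move=> [f [f_lie tE f_comm]]; split.
- rewrite tE => -[|j w].
    by rewrite linear_sum big1 ?eqxx // => i _; apply: coord_nil_letter.
  by rewrite -coord_tail tail_symplectic_derivation eqSS; apply: (f_lie j).1.
- by move=> i w; rewrite tE; apply: coord_rot_derivation.
move=> i; rewrite tE tail_symplectic_derivation; apply: lie_primitive.
exact: (f_lie i).2.
Qed.

Lemma rotate_symplectic_derivation k t :
  (forall w, coord w t != 0 -> size w == k.+2) -> rotate_word t = t ->
  (forall i, lie_element (tail i t)) -> symplectic_derivation k t.
Proof.
move=> tk tr tl; have t0 : coord [::] t = 0 by apply/eqP/negPn/negP => /tk.
have tE : t = \sum_i letter i * tail i t by rewrite {1}(tensor_eta t) t0 scale0r add0r.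
exists (fun i => tail i t); split=> //.
  by move=> i; split; [move=> w; rewrite coord_tail => /tk | apply: tl].
by rewrite sumrB -tE -rotate_tails // tr subrr.
Qed.

Lemma symplectic_derivation_lin k a s t :
  symplectic_derivation k s -> symplectic_derivation k t ->
  symplectic_derivation k (a *: s + t).
Proof.
move=> [f [f_lie sE f_comm]] [h [h_lie tE h_comm]].
exists (fun i => a *: f i + h i); split.
- move=> i; have [fk fl] := f_lie i; have [hk hl] := h_lie i.
  by split; [apply: supp_lin | apply: lie_lin].
- rewrite sE tE scaler_sumr -big_split; apply: eq_bigr => i _ /=.
  by rewrite mulrDr free_scalerAr.
transitivity (a *: (\sum_i (letter i * f i - f i * letter i)) +
    \sum_i (letter i * h i - h i * letter i)); last by rewrite f_comm h_comm scaler0 addr0.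
rewrite scaler_sumr -big_split.
apply: eq_bigr => i _ /=.
by rewrite mulrDr mulrDl free_scalerAr -scalerAl opprD addrACA -scalerBr.
Qed.

Lemma invariant_derivation_subspace k : is_subspace (invariant_derivation k).
Proof.
split=> [|a s t [sd si] [td ti]].
  split=> [|M _]; last exact: linear0.
  exists (fun=> 0); split=> [i||].
  - by split=> [w|]; [rewrite linear0 eqxx | apply: lie_zero].
  - by rewrite big1 // => i _; rewrite mulr0.
  - by rewrite big1 // => i _; rewrite mulr0 mul0r subr0.
split=> [|M sM]; first exact: symplectic_derivation_lin.
by rewrite linearP /= si // ti.
Qed.

Lemma symplectic_letter_det M : symplectic M <-> letter_det x y M = 1.
Proof.
have := letter_symplectic xy xyP M oxx oyy oxy oyx => E1.
by split=> /eqP ?; apply/eqP; rewrite ?E1 // -E1.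
Qed.

Lemma shear_symplectic p q a : p != q -> symplectic (shear p q a).
Proof. by move=> pq; apply/symplectic_letter_det/shear_det. Qed.

Lemma om_anti i j : om j i = - om i j.
Proof.
by case/orP: (xyP i) => /eqP ->; case/orP: (xyP j) => /eqP ->;
  rewrite ?oxx ?oyy ?oxy ?oyx ?oppr0 ?opprK.
Qed.

Lemma om_sq i k : \sum_j om i j * om j k = - (i == k)%:R.
Proof.
have yx : (y == x) = false by rewrite eq_sym; apply: negPf.
rewrite (sum_letters xy xyP).
by case/orP: (xyP i) => /eqP ->; case/orP: (xyP k) => /eqP ->;
  rewrite ?oxx ?oyy ?oxy ?oyx ?eqxx ?yx ?(negPf xy) ?(mulr0, mul0r, mulr1, mul1r, addr0, add0r) ?oppr0.
Qed.

Lemma highest_weight_trace k v : (0 < k)%N ->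
  (forall w, coord w v != 0 -> size w == (2 * k).+2) -> E v = 0 ->
  weight_op x y v = (2 * k - 2)%:R *: v -> cyclic (contract om v) = 0.
Proof.
move=> k0 vk Ev hv; have yx : y != x by rewrite eq_sym.
have supp1 : forall w, coord w (cyclic (contract om v)) != 0 ->
    (size w == (2 * k)%N) && (count_mem y w == 1%N).
  apply: cyclic_supp => [j w|].
    by rewrite size_rot; have /permP -> : perm_eq (rot j w) w by rewrite perm_rot.
  apply: (contract_supp xy xyP oxx oyy) => w wv; rewrite (vk w wv) /=.
  have /eqP := coord_weight_op xy xyP w v; rewrite hv coordZ eq_sym -subr_eq0 -mulrBl.
  rewrite mulf_eq0 (negPf wv) orbF weightE // (eqP (vk w wv)) natrB; last by rewrite leq_pmulr.
  move=> /eqP wE; have : 4%:R = (2 * count_mem y w)%:R :> rat.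
    apply/eqP; rewrite -subr_eq0 -[X in _ == X]wE; apply/eqP.
    by rewrite natrM -[(2 * k).+2]addn2 natrD; ring.
  by move/eqP; rewrite eqr_nat eq_sym -[4%N]/(2 * 2)%N eqn_pmul2l.
apply: (cyclic_one_letter xy xyP _ supp1) => //.
- by rewrite muln_gt0.
- exact: rotate_cyclic.
(* That raising kills the trace is deduced from the shears, since the group action commutes with the
   contraction and with the cyclic sum. *)
apply: (shear_fixed_replace (m := (2 * k)%N) yx) => [w /supp1/andP[]//|a].
rewrite (act_cyclic (m := (2 * k)%N)); last first.
  by apply: contract_size => w /vk.
rewrite act_contract ?shear_symplectic //.
by rewrite (replace_fixed_shear a yx vk Ev).
Qed.

Definition symplectic_stable (V : A -> Prop) : Prop :=
  forall M, symplectic M -> forall t, V t -> V (act M t).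

Lemma symplectic_shear_stable V : symplectic_stable V -> shear_stable x y V.
Proof.
move=> stV a t Vt; have yx : y != x by rewrite eq_sym.
by split; apply: stV => //; apply: shear_symplectic.
Qed.

Lemma shear_symplectic_stable V : shear_stable x y V -> symplectic_stable V.
Proof.
move=> stV M /symplectic_letter_det detM t.
exact: (shear_stable_special xy xyP stV).
Qed.

Lemma irreducible_trace (V : A -> Prop) k : (0 < k)%N -> is_subspace V ->
  (forall s, V s -> forall w, coord w s != 0 -> size w == (2 * k).+2) ->
  symplectic_stable V -> (exists t, V t /\ t <> 0) ->
  (forall W, is_subspace W -> symplectic_stable W -> (forall t, W t -> V t) ->
     (forall t, W t -> t = 0) \/ (forall t, V t -> W t)) ->
  has_dim V (2 * k - 2).+1 -> forall t, V t -> cyclic (contract om t) = 0.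
Proof.
move=> k0 sV Vk stV Vne irrV dimV.
have [v [Vv v0 Ev hv]] : exists v, [/\ V v, v <> 0, E v = 0 &
    weight_op x y v = (2 * k - 2)%:R *: v].
  apply: (irreducible_highest_weight xy xyP sV Vk _ Vne _ dimV).
    exact: symplectic_shear_stable.
  by move=> W sW /shear_symplectic_stable; apply: irrV.
have v_trace := highest_weight_trace k0 (Vk v Vv) Ev hv.
pose W t := V t /\ cyclic (contract om t) = 0.
case: (irrV W) => [|||W0|VW].
- split=> [|a s t [Vs s0] [Vt t0]]; first by split; [case: sV | rewrite !linear0].
  split; first by case: sV => _; apply.
  by rewrite !linearP /= s0 t0 scaler0 addr0.
- move=> M sM t [Vt t0]; split; first exact: stV.
  rewrite -(act_contract _ sM) -(act_cyclic (m := (2 * k)%N)) ?t0 ?linear0 //.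
  exact: contract_size (Vk t Vt).
- by move=> t [].
- by case: v0; apply: W0.
by move=> t /VW[].
Qed.

(** One torus element is enough: the powers of 2 are distinct, so its eigenvalue on a word
    determines the excess of [x] over [y]. *)
Lemma diagonal_count (M : 'M[rat]_n) d t : M x x = 2 -> M x y = 0 -> M y x = 0 ->
  M y y = 2^-1 -> act M t = 2 ^+ d *: t ->
  forall w, coord w t != 0 -> count_mem x w = (count_mem y w + d)%N.
Proof.
move=> Mxx Mxy Myx Myy Mt w wt; have := coord_act_diag xy xyP w t Mxy Myx.
rewrite Mxx Myy Mt coordZ => /(_ erefl)/eqP; rewrite -subr_eq0 -mulrBl mulf_eq0 (negPf wt).
rewrite orbF subr_eq0 eq_sym => /eqP wE; apply: (@ieexprIn rat 2) => //.
by rewrite exprD -wE mulrC divfK // expf_neq0.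
Qed.

Lemma size_count w : size w = (count_mem x w + count_mem y w)%N.
Proof.
have yx : (y == x) = false by rewrite eq_sym; apply: negPf.
elim: w => //= i w ->.
by case/orP: (xyP i) => /eqP ->; rewrite eqxx ?yx ?(negPf xy) ?addSn ?addnS.
Qed.

Definition diagonal2 : 'M[rat]_n := \matrix_(i, j)
  if i == j then (if i == x then 2 else 2^-1) else 0.

Lemma diagonal2_symplectic : symplectic diagonal2.
Proof.
have yx : (y == x) = false by rewrite eq_sym; apply: negPf.
apply/symplectic_letter_det; rewrite /letter_det !mxE !eqxx (negPf xy) yx.
by rewrite mulr0 subr0 divff.
Qed.

Lemma invariant_lie_cyclic t : invariant_derivation 10 t -> lie_cyclic x y 12 6 t.
Proof.
have yx : y != x by rewrite eq_sym.
move=> [/symplectic_derivationP[tk tr tp] ti]; split=> //; last first.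
  by apply: (shear_fixed_replace yx tk) => a; apply/ti/shear_symplectic.
move=> w wt; have := tk w wt; rewrite size_count.
rewrite (@diagonal_count diagonal2 0 t) ?mxE ?eqxx ?(negPf xy) ?(negPf yx) //.
  by rewrite addn0 addnn -[12%N]/(6.*2) (inj_eq double_inj).
by rewrite scale1r ti //; apply: diagonal2_symplectic.
Qed.

Lemma epsilon4_lie_cyclic v : symplectic_derivation 4 v ->
  act diagonal2 v = 2 ^+ 2 *: v -> (forall a, act (shear y x a) v = v) ->
  lie_cyclic x y 6 2 v.
Proof.
have yx : y != x by rewrite eq_sym.
move=> /symplectic_derivationP[vk vr vp] vd vu; split=> //; last first.
  exact: (shear_fixed_replace yx vk).
move=> w wv; have := vk w wv; rewrite size_count.
rewrite (@diagonal_count diagonal2 2 v) ?mxE ?eqxx ?(negPf xy) ?(negPf yx) //.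
by rewrite addnAC addnn -[6%N]/(2.*2 + 2)%N eqn_add2r (inj_eq double_inj).
Qed.

Context (C : certificate).

Local Notation wd := (map (binary_letter x y)).
Local Notation den := (@den n A x y).

Lemma eps4_lie_cyclic : lie_cyclic x y 6 2 (den (eps4 C)).
Proof. exact: trie_lie_cyclic (eps4_lie C) (eps4_count C) (eps4_raise C). Qed.

(** Subtracting the multiple of the explicit vector with the same pivot coordinate leaves a solution
    of a nonsingular homogeneous system. *)
Lemma epsilon4_unique v : lie_cyclic x y 6 2 v -> exists a, v = a *: den (eps4 C).
Proof.
move=> vl; pose p := eps4_pivot C.
exists (coord (wd p) v / rat_of_Z (trie_coord p (eps4 C))).
set a := _ / _; apply/eqP; rewrite -subr_eq0 addrC -scaleNr; apply/eqP.
apply: (symplectic_lie_determined_by xy xyP (lie_cyclic_lin _ eps4_lie_cyclic vl)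
  (eps4_proper C) _ (eps4_determined C)) => q.
rewrite inE => /eqP ->; rewrite coordP coord_den // mulNr divfK ?addNr //.
by rewrite rat_of_Z_eq0 eps4_pivot_neq0.
Qed.

Lemma trie_invariantP r : trie_invariant r -> invariant_derivation 10 (den r).
Proof.
have yx : y != x by rewrite eq_sym.
move=> /and3P[/(trie_symplectic_lieP (A := A) xy xyP (ltn0Sn 10))[rk rr rl] rE rF].
split; first exact: rotate_symplectic_derivation.
move=> M sM; apply: (shear_symplectic_stable (V := fun t => t = den r)) => // a _ ->.
split; apply: replace_fixed_shear => //; [exact: rk | | exact: rk |].
  by rewrite den_lower // trie_is0P.
by rewrite den_raise // trie_is0P.
Qed.

Definition invariant i : A := den (inv C i).

Lemma invariantP i : (i < 3)%N -> invariant_derivation 10 (invariant i).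
Proof. by move=> i3; apply/trie_invariantP/inv_invariant. Qed.

Lemma coord_pivot_neq0 i : (i < 3)%N -> coord (wd (pivot C i)) (invariant i) != 0.
Proof. by move=> i3; rewrite coord_den // rat_of_Z_eq0 pivot_neq0. Qed.

Lemma coord_pivot_eq0 i j : (i < j < 3)%N -> coord (wd (pivot C i)) (invariant j) = 0.
Proof. by move=> ij; rewrite coord_den // pivot_eq0. Qed.

(** The pivot coordinates are triangular on the explicit invariants, so multiples can be subtracted
    one by one without disturbing the earlier pivots; the remainder solves a nonsingular system. *)
Lemma invariant_decomposition t : invariant_derivation 10 t ->
  exists c : 'I_3 -> rat, t = \sum_i c i *: invariant i.
Proof.
move=> ti; have sub := invariant_derivation_subspace 10.
have step i s : (i < 3)%N -> invariant_derivation 10 s ->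
    (forall j, (j < i)%N -> coord (wd (pivot C j)) s = 0) ->
    exists a, invariant_derivation 10 (s - a *: invariant i) /\
      forall j, (j < i.+1)%N -> coord (wd (pivot C j)) (s - a *: invariant i) = 0.
  move=> i3 si s0; exists (coord (wd (pivot C i)) s / coord (wd (pivot C i)) (invariant i)).
  set a := _ / _; split; first by apply: subspaceB => //; apply: subspaceZ => //; apply: invariantP.
  move=> j; rewrite ltnS leq_eqVlt linearB linearZ /= => /orP[/eqP ->|ji].
    by rewrite /a [_ *: _]divfK ?subrr // coord_pivot_neq0.
  by rewrite s0 // coord_pivot_eq0 ?ji // scaler0 subr0.
have [a0 [i0 p0]] := step 0%N t isT ti (fun j j0 => match notF j0 with end).
have [a1 [i1 p1]] := step 1%N _ isT i0 p0; have [a2 [i2 p2]] := step 2%N _ isT i1 p1.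
exists (fun i => nth 0 [:: a0; a1; a2] i).
rewrite !big_ord_recl big_ord0 addr0 /= /bump /=; apply/eqP; rewrite -subr_eq0 !opprD !addrA.
apply/eqP; apply: (symplectic_lie_determined_by xy xyP (invariant_lie_cyclic i2)
  (inv_proper C) _ (inv_determined C)) => _ /mapP[j j3 ->]; apply: p2.
by rewrite mem_iota in j3.
Qed.

Lemma invariant_dim : has_dim (invariant_derivation 10) 3.
Proof.
exists (fun i : 'I_3 => invariant i); split; last first.
  move=> t; split=> [|[c ->]]; first exact: invariant_decomposition.
  have sub := invariant_derivation_subspace 10.
  by apply: subspace_sum => // i; apply: subspaceZ => //; apply: invariantP.
move=> c c0; have step (i : 'I_3) : (forall j : 'I_3, (j < i)%N -> c j = 0) -> c i = 0.
  move=> ci; have := congr1 (coord (wd (pivot C i))) c0.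
  rewrite linear0 linear_sum (bigD1 i) //= big1 ?addr0 => [|j ji]; last first.
    rewrite linearZ /=; case: (ltngtP j i) => [/ci -> | ij | /val_inj jiE].
    - by rewrite scale0r.
    - by rewrite coord_pivot_eq0 ?ij ?ltn_ord // scaler0.
    by rewrite jiE eqxx in ji.
  rewrite linearZ /= => /eqP; rewrite mulf_eq0 (negPf (coord_pivot_neq0 _)) ?orbF //.
  by move/eqP.
suff H m (i : 'I_3) : (i < m)%N -> c i = 0 by move=> i; apply: (H 3).
elim: m i => // m IHm i; rewrite ltnS leq_eqVlt => /orP[/eqP im|]; last exact: IHm.
by apply: step => j; rewrite im; apply: IHm.
Qed.

Definition trace_of v t : A := cyclic (contract om (bracket om v t)).

Lemma trace_eps4 t : (forall j, coord [:: j] t = 0) ->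
  trace_of (den (eps4 C)) t = cyclic (derive (derivation om (den (eps4 C))) (contract om t)).
Proof.
move=> t1; rewrite /trace_of cyclic_contract_bracket //; [|exact: om_anti|exact: om_sq|].
  have e0 : cyclic (contract om (den (eps4 C))) = 0.
    rewrite -den_contract // -(den_cyclic xy xyP (eps4_contract C)).
    exact/trie_is0P/eps4_cyclic.
  by rewrite [X in _ - X]cyclic_derive e0 !linear0 addr0.
have [em _ _ _ _] := eps4_lie_cyclic => j.
by apply/eqP/negPn/negP => /em.
Qed.

(** The contraction has length 10 and epsilon_4 adds four letters, whence the 14 rotations. *)
Lemma trace_eps4_invariant i : (i < 3)%N -> trace_of (den (eps4 C)) (invariant i) =
  den (trie_cyclic 14 (trie_action (eps4 C) (inv C i))).
Proof.
move=> i3; rewrite trace_eps4; last first.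
  have [/symplectic_derivationP[im _ _] _] := invariantP i3 => j.
  by apply/eqP/negPn/negP => /im.
rewrite (den_cyclic xy xyP (action_homog C i3)) den_derive //.
rewrite (den_contract xy xyP _ oxx oyy oxy oyx); congr cyclic.
apply: eq_derive => j; rewrite /derivation (sum_letters xy xyP) /=.
case/orP: (xyP j) => /eqP ->; rewrite ?oxx ?oyy ?oxy ?oyx ?eqxx.
  by rewrite scale0r add0r scale1r -[y]/(binary_letter x y true) tail_den.
rewrite eq_sym (negPf xy) scale0r addr0 den_scale -(tail_den (A := A) xy false).
by congr (_ *: _).
Qed.

Lemma trace_of_lin v : linear (trace_of v).
Proof.
move=> a s t; rewrite /trace_of bracket_anti bracket_linl opprD -scalerN.
by rewrite -!(bracket_anti om v) !linearP.
Qed.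

HB.instance Definition _ v := GRing.isLinear.Build rat A A _ (trace_of v) (trace_of_lin v).

Lemma trace_ofZ a v t : trace_of (a *: v) t = a *: trace_of v t.
Proof.
have := bracket_linl om a v 0 t; rewrite addr0 /trace_of => ->.
have -> : bracket om 0 t = 0.
  by have := bracket_linl om (-1) 0 0 t; rewrite !scaleN1r oppr0 addr0 addNr.
by rewrite addr0 !linearZ.
Qed.

Lemma trace_of_eq0C s t : trace_of s t = 0 -> trace_of t s = 0.
Proof.
by move=> st0; rewrite -[RHS]oppr0 -st0 /trace_of [bracket om t s]bracket_anti !linearN.
Qed.

(** Index 0 has trace zero, and the probe coordinates of the other two traces form a triangular
    matrix with nonzero diagonal, so their coefficients vanish in turn. *)
Lemma invariant_trace_eq0 v t : lie_cyclic x y 6 2 v -> v <> 0 ->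
  invariant_derivation 10 t -> trace_of v t = 0 <-> exists c, t = c *: invariant 0.
Proof.
move=> /epsilon4_unique[a ->] v0 /invariant_decomposition[c ->].
have {v0} a0 : a != 0 by apply/eqP => a0; rewrite a0 scale0r in v0.
have inv0 : trace_of (den (eps4 C)) (invariant 0) = 0.
  by rewrite trace_eps4_invariant //; apply/trie_is0P/action_eq0.
rewrite trace_ofZ; split; last first.
  by move=> [d ->]; rewrite linearZ /= inv0 !scaler0.
move/eqP; rewrite scaler_eq0 (negPf a0) /= !big_ord_recl big_ord0 addr0 !linearD !linearZ /=.
rewrite inv0 scaler0 add0r => /eqP.
rewrite /bump /= !trace_eps4_invariant // => tr0.
have cprobe (b : rat) (i : nat) : (0 < i < 3)%N ->
    b * coord (wd (probe C i)) (den (trie_cyclic 14 (trie_action (eps4 C) (inv C i)))) = 0 ->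
    b = 0.
  move=> i3 /eqP; rewrite mulf_eq0 coord_den // rat_of_Z_eq0.
  by rewrite (negPf (probe_neq0 C i3)) orbF => /eqP.
have c1 : c (lift ord0 ord0) = 0.
  apply: (cprobe _ 1%N) => //; have := congr1 (coord (wd (probe C 1))) tr0.
  by rewrite coordD !coordZ linear0 [X in _ + _ * X]coord_den // probe_eq0 mulr0 addr0.
have c2 : c (lift ord0 (lift ord0 ord0)) = 0.
  apply: (cprobe _ 2%N) => //; have := congr1 (coord (wd (probe C 2))) tr0.
  by rewrite c1 scale0r add0r coordZ linear0.
by exists (c ord0); rewrite c1 c2 !scale0r !addr0.
Qed.

Lemma invariant0_neq0 : invariant 0 != 0.
Proof.
apply/eqP => i0; have := coord_pivot_neq0 (isT : 0 < 3)%N.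
by rewrite i0 linear0 eqxx.
Qed.

End SymplecticDerivations.

(** * The explicit tensors and their verification *)

Section Certificate.
Local Open Scope string_scope.
Local Open Scope Z_scope.
(* The coefficients below were found by linear algebra; [sigma5] is chosen in the
   kernel of the trace of the bracket with [epsilon4]. *)
Definition epsilon4 : trie := trie_cyclic 6 (trie_sum
  [:: (1, trie_of_bits (bits "xxxxyy")); (-4, trie_of_bits (bits "xxxyxy"));
      (3, trie_of_bits (bits "xxyxxy"))]).

Definition sigma5 : trie := matching_sum
  [:: (7, "()()()()()()"); (-48, "()()()()(())"); (148, "()()()(()())");
      (-6, "()()()((()))"); (-16, "()()(())(())"); (-5, "()()(()(()))");
      (-5, "()()((())())"); (3, "()()((()()))"); (1, "()()(((())))");
      (-9, "()(())()(())"); (3, "()(())((()))"); (3, "()((()))(())");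
      (-2, "()((())(()))")].

Definition invariant1 : trie := matching_sum
  [:: (-1, "()()()()(())"); (8, "()()()(()())"); (-2, "()()(())(())");
      (-2, "()()(()(()))"); (-2, "()()((())())"); (1, "()()((()()))");
      (-2, "()(())()(())")].

Definition invariant2 : trie := matching_sum
  [:: (-1, "()()()()()()"); (5, "()()()()(())"); (-10, "()()()(()())")].

Definition pivot1 := bits "xxxxxyxyyyyy".
Definition pivot2 := bits "xxxxyxyyyyxy".
Definition pivot3 := bits "xxyyxxyyxxyy".

(** Raising gives 66 equations, one for each necklace with five letters y. These 11 shuffles and the
    3 pivots complete them to a square system in 80 unknowns. *)
Definition invariant_shuffles : seq (bool * (seq bool * seq bool)) :=
  [seq (false, (bits s.1, bits s.2)) | s <-
    [:: ("x", "yyyyyyxxxx"); ("x", "yyyyyxyxxx"); ("x", "yyyyyxxyxx"); ("x", "yyyyxyyxxx");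
        ("x", "yyyyxyxyxx"); ("x", "yyyyxyxxyx"); ("x", "yyyyxxyxyx"); ("x", "yyyxyyxyxx");
        ("yx", "yyyyxyxxx"); ("yx", "yyyxyxyxx"); ("yx", "yyxyxyxyx")]].

(** Index 0 is reserved for the tensor spanning the kernel; the probes concern indices 1 and 2. *)
Definition genus1_invariant (i : nat) : trie :=
  if i is i'.+1 then (if i' is _.+1 then invariant2 else invariant1) else sigma5.

Definition genus1_pivot (i : nat) : seq bool :=
  if i is i'.+1 then (if i' is _.+1 then pivot3 else pivot2) else pivot1.

Definition genus1_probe (i : nat) : seq bool :=
  if i is 1%N then bits "xxxxxxyyxxyyyy" else bits "xxxxyxyxxyyyxy".

Lemma genus1_certificate : certificate.
Proof.
(* Bounded quantifiers are turned into [all] over an [iota], which evaluation decides. *)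
have iotaP (P : pred nat) m k : all P (iota m k) -> forall i, (m <= i < m + k)%N -> P i.
  by move=> /allP Pm i mi; apply: Pm; rewrite mem_iota.
refine (@Certificate epsilon4 _ _ _ _ _ (bits "xxxxyy") _
  [:: (true, (bits "x", bits "xxxy"))] _ _ genus1_invariant _ genus1_pivot _ _
  invariant_shuffles _ _ _ _ genus1_probe _ _).
1-8: vm_compute; reflexivity.
- by apply: (iotaP _ 0%N 3%N); vm_compute; reflexivity.
- move=> i j /andP[ij j3]; apply/Z.eqb_spec; move: i ij; apply: (iotaP _ 0%N j).
  move: j j3; apply: (iotaP (fun j => all _ (iota 0 j)) 0%N 3%N).
  by vm_compute; reflexivity.
- by apply: (iotaP _ 0%N 3%N); vm_compute; reflexivity.
1-2: vm_compute; reflexivity.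
- by apply: (iotaP _ 0%N 3%N); vm_compute; reflexivity.
1-2: vm_compute; reflexivity.
- by apply: (iotaP _ 1%N 2%N); vm_compute; reflexivity.
Qed.

End Certificate.

(** At most a scalar survives the contraction, and the cyclic sum of the empty word has no terms. *)
Lemma cyclic_contract_short n (A : free_algebra n) (om : 'M[rat]_n) w :
  (size w <= 2)%N -> cyclic (contract om (word w : A)) = 0.
Proof.
case: w => [|i [|j [|//]]] _; rewrite /contract extend_word ?linear0 //.
by rewrite linearZ /= cyclic_word big_ord0 scaler0.
Qed.

(** This covers epsilon_0, a derivation of degree 0 and so a tensor of length 2. *)
Lemma traceless_size2 n (A : free_algebra n) (om : 'M[rat]_n) (t : A) :
  (forall w, coord w t != 0 -> size w == 2) -> traceless om t.
Proof.
move=> t2; split; first by move=> w /t2/eqP ->.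
move: t2; apply: (@supp_ext _ A A (fun s => cyclic (contract om s)) (fun=> 0)
  (fun w => size w == 2)) => [||w /eqP w2].
- exact: comp_lin cyclic_lin (contract_lin _).
- exact: zero_lin.
by apply: cyclic_contract_short; rewrite w2.
Qed.

Lemma traceless0 n (A : free_algebra n) (om : 'M[rat]_n) : traceless om (0 : A).
Proof. by split=> [w|]; rewrite !linear0 ?eqxx. Qed.

Lemma traceless_lin n (A : free_algebra n) (om : 'M[rat]_n) a (s t : A) :
  traceless om s -> traceless om t -> traceless om (a *: s + t).
Proof.
move=> [se s0] [te t0]; split; first exact: even_supp_lin.
by rewrite !linearP /= s0 t0 scaler0 addr0.
Qed.

Lemma symplectic_derivation_even n (A : free_algebra n) k (t : A) :
  symplectic_derivation (2 * k) t -> even_supp t.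
Proof.
by move=> /symplectic_derivationP[tk _ _] w /tk/eqP ->; rewrite /= mul2n odd_double.
Qed.

Lemma has_dim1 (V : lmodType rat) (P : V -> Prop) u : u != 0 ->
  (forall v, P v <-> exists c, v = c *: u) -> has_dim P 1.
Proof.
move=> u0 Pu; exists (fun=> u); split=> [c|v].
  rewrite big_ord1 => /eqP; rewrite scaler_eq0 (negPf u0) orbF => /eqP c0 i.
  by rewrite ord1.
split=> [/Pu[c ->]|[c ->]]; first by exists (fun=> c); rewrite big_ord1.
by rewrite big_ord1; apply/Pu; exists (c ord0).
Qed.

Lemma scale_line (V : lmodType rat) (u s t : V) c : s = c *: u -> s <> 0 ->
  (exists d, t = d *: u) <-> (exists d, t = d *: s).
Proof.
move=> -> s0; have c0 : c != 0 by apply/eqP => c0; rewrite c0 scale0r in s0.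
split=> -[d ->]; first by exists (d / c); rewrite scalerA divfK.
by exists (d * c); rewrite scalerA.
Qed.

(** * The tensor algebra as an instance of the interface *)

Section TensorAlgebra.

Context {g : nat}.
Implicit Types (s t : tensor g) (w : seq 'I_(g + g)).

Definition tensor_coord w t : rat := t@_(FMonom w).

Lemma tensor_coord_linear w : linear (tensor_coord w : tensor g -> rat^o).
Proof. by move=> a s t; rewrite /tensor_coord mcoeffD mcoeffZ. Qed.

Lemma tensor_coord_inj s t : (forall w, tensor_coord w s = tensor_coord w t) -> s = t.
Proof. by move=> eq_st; apply/malgP => w; rewrite -(fmK w); apply: eq_st. Qed.

Lemma tensor_coord_mon v w : tensor_coord w (mon v) = (v == w)%:R.
Proof. by rewrite /tensor_coord /mon mcoeffU1 fmP. Qed.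

(** Supports are not additive; summing over a common larger finite set makes linearity visible. *)
Lemma linextEw F t (d : {fset {fmonom 'I_(g + g)}}) :
  (msupp t `<=` d)%fset -> linext F t = \sum_(w <- d) t@_w *: F w.
Proof.
move=> le_td; rewrite /linext (big_fset_incl _ le_td) // => w _ /mcoeff_outdom ->.
by rewrite scale0r.
Qed.

Lemma linext_linear F : linear (@linext g F).
Proof.
move=> a s t; pose d := (msupp s `|` msupp t)%fset.
have sd : (msupp s `<=` d)%fset by apply: fsubsetUl.
have td : (msupp t `<=` d)%fset by apply: fsubsetUr.
have std : (msupp (a *: s + t) `<=` d)%fset.
  by apply: fsubset_trans (msuppD_le _ _) _; apply: fsetSU; apply: msuppZ_le.
rewrite (linextEw _ sd) (linextEw _ td) (linextEw _ std) scaler_sumr -big_split.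
by apply: eq_bigr => w _; rewrite mcoeffD mcoeffZ scalerDl scalerA.
Qed.

Lemma linext_mon F w : linext F (mon w) = F w.
Proof. by rewrite (linextEw _ (msuppU_le (x := 1))) big_seq_fset1 mcoeffUU scale1r. Qed.

Lemma tensor_span t : exists r, t = \sum_(w <- r) tensor_coord w t *: mon w.
Proof.
exists (map (@fmonom_val _) (enum_fset (msupp t))); rewrite big_map {1}[t]monalgE.
apply: eq_bigr => w _; apply/malgP => u; rewrite mcoeffZ !mcoeffU /tensor_coord !fmK.
by rewrite mulr_natr.
Qed.

Lemma mon_nil : mon [::] = 1 :> tensor g.
Proof. by rewrite /mon -fmoneE. Qed.

Lemma mon_cat u v : mon (u ++ v) = mon u * mon v :> tensor g.
Proof. by rewrite /mon malgM_def fgmulUU mulr1 [mmul _ _]fmmulE. Qed.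

Lemma tensor_scalerAr (a : rat) s t : s * (a *: t) = a *: (s * t).
Proof.
suff cent (c : rat) (x : tensor g) : x * c%:MP = c%:MP * x.
  by rewrite -!mul_malgC mulrA cent mulrA.
rewrite !malgM_def fgmulgU fgmulUg; apply: eq_bigr => w _.
by rewrite mulrC mulm1 mul1m.
Qed.

End TensorAlgebra.

Definition tensor_algebra (g : nat) : free_algebra (g + g) :=
  @FreeAlgebra (g + g) (tensor g) (@mon g) tensor_coord (@linext g)
    tensor_scalerAr mon_nil mon_cat tensor_coord_mon tensor_coord_linear
    tensor_coord_inj tensor_span linext_linear linext_mon.

(** * Translation of the stated notions into the interface *)

Section Bridge.

Context {g : nat}.
Local Notation A := (tensor_algebra g).

Lemma homogP k (t : A) : homog k t <-> forall w, coord w t != 0 -> size w == k.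
Proof.
split=> ht w; first by rewrite [coord w t]/(t@_(FMonom w)) mcoeff_neq0 => /ht /eqP.
rewrite -mcoeff_neq0 -[w in t@_w]fmK => wt.
exact/eqP/(ht (w : seq _) wt).
Qed.

Lemma sder_symplectic k (t : A) : sder k t <-> symplectic_derivation k t.
Proof.
split=> -[f [f_lie tE f_comm]]; exists f; split=> // i; have [fk fl] := f_lie i.
  by split=> //; apply/homogP.
by split=> //; apply/homogP.
Qed.

Lemma sder_inv_invariant k (t : A) : sder_inv k t <-> invariant_derivation (omega g) k t.
Proof. by split=> -[/sder_symplectic tk ti]. Qed.

Lemma ES_word w : ES (mon w) = if (4 <= size w)%N then
  cyclic (contract (omega g) (word w : A)) else 0.
Proof. exact: linext_mon. Qed.

(** The length test matters only below length 4; even words there have length 0 or 2, where the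
    contracted cyclic sum is zero anyway. *)
Lemma ES_trace (t : A) : even_supp t -> ES t = cyclic (contract (omega g) t).
Proof.
apply: (@supp_ext _ A A (@ES g) (fun s => cyclic (contract (omega g) s))
  (fun w => ~~ odd (size w))) => [||w ew].
- exact: linext_linear.
- exact: comp_lin cyclic_lin (contract_lin _).
rewrite [LHS]ES_word; case: leqP => // w4; apply/esym.
apply: cyclic_contract_short; case: (size w) w4 ew => [|[|[|[|]]]] //.
Qed.

Lemma der_derive (t u : A) : der t u = derive (derivation (omega g) t) u.
Proof.
have wordE w : der_word t w = derive_word (derivation (omega g) t : _ -> A) w.
  elim: w => [|i w IHw]; first exact: erefl.
  exact: (congr1 (fun u : A => derivation (omega g) t i * word w + letter i * u) IHw).
by apply: eq_bigr => w _; congr (_ *: _); apply: wordE.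
Qed.

Lemma der_gen_derivation (t : A) (i : 'I_(g + g)) :
  der t (gen i) = derivation (omega g) t i.
Proof. exact: etrans (der_derive t (gen i)) (@derive_letter _ A _ i). Qed.

Lemma der_br_bracket (s t : A) : der_br s t = bracket (omega g) s t.
Proof.
apply: eq_bigr => i _; apply: eq_bigr => j _.
by rewrite !der_gen_derivation !der_derive.
Qed.

End Bridge.

(** * Genus one: the generated algebra and the kernel line *)

Section GenusOne.

Local Notation A := (tensor_algebra 1).

Definition x1 : 'I_(1 + 1) := lshift 1 ord0.
Definition y1 : 'I_(1 + 1) := rshift 1 ord0.

Lemma x1_neq_y1 : x1 != y1.
Proof. by []. Qed.

Lemma genus1_letter (i : 'I_(1 + 1)) : (i == x1) || (i == y1).
Proof. by case: i => [[|[|]]]. Qed.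

Lemma omega_xx : omega 1 x1 x1 = 0.
Proof. by rewrite /omega block_mxEul mxE. Qed.

Lemma omega_yy : omega 1 y1 y1 = 0.
Proof. by rewrite /omega block_mxEdr mxE. Qed.

Lemma omega_xy : omega 1 x1 y1 = 1.
Proof. by rewrite /omega block_mxEur mxE. Qed.

Lemma omega_yx : omega 1 y1 x1 = -1.
Proof. by rewrite /omega block_mxEdl !mxE. Qed.

Lemma torus_diagonal2 : torus 2 = diagonal2 x1.
Proof.
apply/matrixP => i j; rewrite [in RHS]mxE /torus.
case/orP: (genus1_letter i) => /eqP ->; case/orP: (genus1_letter j) => /eqP ->.
- by rewrite block_mxEul mxE eqxx.
- by rewrite block_mxEur mxE.
- by rewrite block_mxEdl mxE.
by rewrite block_mxEdr mxE eqxx.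
Qed.

Lemma unipotent_shear a : unipotent a = shear y1 x1 a.
Proof.
apply/matrixP => i j; rewrite /unipotent /shear.
case/orP: (genus1_letter i) => /eqP ->; case/orP: (genus1_letter j) => /eqP ->.
- by rewrite block_mxEul !mxE /= ?mulr0 ?mulr1 ?addr0 ?add0r.
- by rewrite block_mxEur !mxE /= ?mulr0 ?mulr1 ?addr0 ?add0r.
- by rewrite block_mxEdl !mxE /= ?mulr0 ?mulr1 ?addr0 ?add0r.
by rewrite block_mxEdr !mxE /= ?mulr0 ?mulr1 ?addr0 ?add0r.
Qed.

Lemma omega_anti (i j : 'I_(1 + 1)) : omega 1 j i = - omega 1 i j.
Proof. exact: (om_anti genus1_letter omega_xx omega_yy omega_xy omega_yx). Qed.

Lemma omega_sq (i k : 'I_(1 + 1)) : \sum_j omega 1 i j * omega 1 j k = - (i == k)%:R.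
Proof. exact: (om_sq x1_neq_y1 genus1_letter omega_xx omega_yy omega_xy omega_yx). Qed.

Lemma eps_summand_traceless k (V : A -> Prop) (t : A) : (1 <= k)%N ->
  eps_summand k V -> V t -> traceless (omega 1) t.
Proof.
move=> k0 [Vs [[[sV stV] Vne irrV] dimV]] Vt.
split; first by apply: (@symplectic_derivation_even _ _ k); apply/sder_symplectic/Vs.
have Vk (s : A) : V s -> forall w, coord w s != 0 -> size w == (2 * k).+2.
  by move=> /Vs/sder_symplectic/symplectic_derivationP[].
apply: (@irreducible_trace _ A x1 y1 x1_neq_y1 genus1_letter (omega 1)
  omega_xx omega_yy omega_xy omega_yx V k k0 sV Vk stV Vne _ dimV t Vt).
by move=> W sW stW; apply: irrV (conj sW stW).
Qed.

Lemma u_alg_traceless (t : A) : u_alg t -> traceless (omega 1) t.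
Proof.
elim=> {t} [v [[|k]]|||].
- move=> [/sder_symplectic/symplectic_derivationP[v2 _ _] _ _ _].
  exact: traceless_size2.
- by move=> [V [epsV [Vv _ _ _]]]; apply: eps_summand_traceless epsV Vv.
- exact: (@traceless0 _ A).
- by move=> a s t _ s0 _ t0; apply: (@traceless_lin _ A).
move=> s t _ s0 _ t0; rewrite der_br_bracket.
exact: (bracket_traceless omega_anti omega_sq).
Qed.

Lemma traceless_ES (t : A) : traceless (omega 1) t -> ES t = 0.
Proof. by move=> [te t0]; rewrite ES_trace. Qed.

Lemma ES_der_br (s t : A) : even_supp s -> even_supp t ->
  ES (der_br s t) = trace_of (omega 1) s t.
Proof. by move=> se te; rewrite der_br_bracket ES_trace //; apply: bracket_even. Qed.

Lemma epsilon4_derivation (v : A) : is_epsilon 2 v ->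
  [/\ symplectic_derivation 4 v, lie_cyclic x1 y1 6 2 v & v <> 0].
Proof.
move=> [V [[Vs _] [Vv v0 vT vU]]]; have /sder_symplectic v4 := Vs v Vv.
split=> //; apply: (epsilon4_lie_cyclic x1_neq_y1 genus1_letter v4) => [|a].
  by rewrite -torus_diagonal2; apply: (vT 2).
by rewrite -unipotent_shear; apply: vU.
Qed.

Local Notation inv0 := (@invariant _ A x1 y1 genus1_certificate 0).

Lemma epsilon4_kernel (v t : A) : is_epsilon 2 v -> sder_inv 10 t ->
  ES (der_br v t) = 0 <-> exists c, t = c *: inv0.
Proof.
move=> /epsilon4_derivation[v4 vl v0] /sder_inv_invariant tI.
have ve : even_supp v := @symplectic_derivation_even _ A 2 v v4.
have te : even_supp t := @symplectic_derivation_even _ A 5 t tI.1.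
rewrite ES_der_br //.
exact: (invariant_trace_eq0 x1_neq_y1 genus1_letter omega_xx omega_yy omega_xy omega_yx
  genus1_certificate vl v0 tI).
Qed.

Lemma sigma5_line (v s : A) : is_epsilon 2 v -> is_sigma5 s -> exists c, s = c *: inv0.
Proof.
move=> v4 [sI s0 su]; apply/(epsilon4_kernel v4 sI).
have vu : u_alg v by apply: lie_gen; exists 2%N.
have [ve _] := u_alg_traceless vu.
have se : even_supp s := @symplectic_derivation_even _ A 5 s (proj1 (sder_inv_invariant 10 s) sI).1.
(* The normalizer condition concerns the bracket of [s] with [v]; the kernel condition has the two
   exchanged, which costs a sign. *)
have sv0 : trace_of (omega 1) s v = 0 :=
  etrans (esym (ES_der_br se ve)) (traceless_ES (u_alg_traceless (su v vu))).
exact: (etrans (ES_der_br ve se) (@trace_of_eq0C _ A (omega 1) s v sv0)).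
Qed.

Lemma inv0_neq0 : inv0 != 0.
Proof. exact: invariant0_neq0 x1_neq_y1 _. Qed.

Lemma inv0_sder : sder_inv 10 inv0.
Proof.
apply/sder_inv_invariant; apply: (invariantP x1_neq_y1 genus1_letter omega_xx omega_yy
  omega_xy omega_yx genus1_certificate (i := 0)).
by [].
Qed.

End GenusOne.

Theorem theorem8p5 :
  (* (i) *)
  ((forall (k : nat) (V : tensor 1 -> Prop), (1 <= k)%N -> eps_summand k V ->
      forall t : tensor 1, V t -> ES t = 0) /\
   (forall t : tensor 1, u_alg t -> ES t = 0)) /\
  (* (ii) *)
  ((forall e4 s5 : tensor 1, is_epsilon 2 e4 -> is_sigma5 s5 ->
      forall t : tensor 1, sder_inv 10 t ->
        (ES (der_br e4 t) = 0 <-> exists c : rat, t = c *: s5)) /\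
   (forall e4 : tensor 1, is_epsilon 2 e4 ->
      has_dim (fun t : tensor 1 => sder_inv 10 t /\ ES (der_br e4 t) = 0) 1) /\
   has_dim (fun t : tensor 1 => sder_inv 10 t) 3).
Proof.
split; [split=> [k V k0 epsV t Vt | t ut] | split; [|split]].
- exact: traceless_ES (eps_summand_traceless k0 epsV Vt).
- exact: traceless_ES (u_alg_traceless ut).
(* [s5] is a nonzero multiple of the explicit invariant, so both span the same line. *)
- move=> e4 s5 e4P s5P t tI; have [c s5E] := sigma5_line e4P s5P.
  have [_ s50 _] := s5P; apply: iff_trans (epsilon4_kernel e4P tI) _.
  exact: scale_line s5E s50.
- move=> e4 e4P; apply: (has_dim1 inv0_neq0) => t; split=> [[tI]|[c ->]].
    by move/(epsilon4_kernel e4P tI).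
  have cI : sder_inv 10 (c *: @invariant _ (tensor_algebra 1) x1 y1 genus1_certificate 0).
    apply/sder_inv_invariant; apply: subspaceZ; first exact: invariant_derivation_subspace.
    exact/sder_inv_invariant/inv0_sder.
  by split=> //; apply/(epsilon4_kernel e4P cI); exists c.
have [b [b_free b_span]] := invariant_dim (A := tensor_algebra 1) x1_neq_y1 genus1_letter
  omega_xx omega_yy omega_xy omega_yx genus1_certificate.
exists b; split=> // t; apply: iff_trans (b_span t).
exact: sder_inv_invariant.
Qed.
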